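(* Let $\omega\in C[0,1]$ be a complex oscillation. Then for (Lebesgue-)almost all $t\in[0,1]$, $$\limsup_{h\to 0}\frac{|\omega(t+h)-\omega(t)|}{\sqrt{2|h|\log\log(1/|h|)}}=1 .$$
   Context: $C[0,1]$ is the space of continuous real-valued functions on $[0,1]$ with the uniform norm. In the limsup, $h\neq 0$ ranges over reals with $t+h\in[0,1]$. For $n\ge 1$, $C_n$ is the class of continuous functions on $[0,1]$ that vanish at $0$ and are linear with slope $\pm\sqrt n$ on each interval $[(i-1)/n,i/n]$, $i=1,\dots,n$. To $x\in C_n$ one associates its code $c(x)=a_1\cdots a_n\in\{1,-1\}^n$ (regarded as a binary string of length $n$), where $a_i=1$ if $x$ increases and $a_i=-1$ if $x$ decreases on $[(i-1)/n,i/n]$. A sequence $\{x_n\}_{n\ge 1}$ in $C[0,1]$ is complex if $x_n\in C_n$ for each $n$ and there is a constant $d\in\mathbb N$ such that $K(c(x_n))\ge n-d$ for all $n$, where $K$ denotes prefix-free Kolmogorov complexity. A function $x\in C[0,1]$ is a complex oscillation if there is a complex sequence $\{x_n\}$ such that $x_n-x$ converges effectively to $0$ in the uniform norm, i.e. there is a computable function $\psi:\mathbb N\to\mathbb N$ such that $\|x_n-x\|_\infty\le 2^{-k}$ whenever $n\ge\psi(k)$. *)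

(* Defs.v *)
From HB Require Import structures.
From mathcomp Require Import all_boot all_order all_algebra.
From mathcomp Require Import all_classical all_reals all_analysis.

Set Implicit Arguments.
Unset Strict Implicit.
Unset Printing Implicit Defensive.

Import Order.TTheory GRing.Theory Num.Theory.
Import numFieldNormedType.Exports.

Local Open Scope classical_set_scope.
Local Open Scope ring_scope.

(** ** Partial recursive functions

    A [k]-ary partial function on [nat] is represented by its graph. *)

Definition pfun (k : nat) := k.-tuple nat -> nat -> Prop.

Definition pcomp (m k : nat) (f : pfun m) (g : 'I_m -> pfun k) : pfun k :=
  fun v y => exists2 w : m.-tuple nat, (forall i, g i v (tnth w i)) & f w y.

(* [s] is the course of values of the recursion up to its first argument. *)
Definition pprec (k : nat) (f : pfun k) (g : pfun k.+2) : pfun k.+1 :=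
  fun v y => exists s : nat -> nat,
    [/\ f [tuple of behead v] (s 0%N),
        (forall i : nat, (i < thead v)%N ->
           g [tuple of i :: s i :: behead v] (s i.+1))
      & y = s (thead v)].

Definition pmin (k : nat) (f : pfun k.+1) : pfun k :=
  fun v y => f [tuple of y :: v] 0%N /\
    forall i : nat, (i < y)%N -> exists z : nat, f [tuple of i :: v] z.+1.

Inductive partial_recursive : forall k : nat, pfun k -> Prop :=
| PRzero k : partial_recursive (fun (_ : k.-tuple nat) y => y = 0%N)
| PRsucc : partial_recursive (fun (v : 1.-tuple nat) y => y = (thead v).+1)
| PRproj k (i : 'I_k) :
    partial_recursive (fun (v : k.-tuple nat) y => y = tnth v i)
| PRcomp m k (f : pfun m) (g : 'I_m -> pfun k) :
    partial_recursive f -> (forall i, partial_recursive (g i)) ->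
    partial_recursive (pcomp f g)
| PRprec k (f : pfun k) (g : pfun k.+2) :
    partial_recursive f -> partial_recursive g ->
    partial_recursive (pprec f g)
| PRmin k (f : pfun k.+1) :
    partial_recursive f -> partial_recursive (pmin f).

Definition computable_fun (psi : nat -> nat) : Prop :=
  partial_recursive (fun (v : 1.-tuple nat) y => y = psi (thead v)).

(** ** Prefix-free Kolmogorov complexity *)

(* Bijective base-2 numeration: a bijection from [seq bool] onto [nat]. *)
Fixpoint nat_of_bits (s : seq bool) : nat :=
  if s is b :: s' then ((nat_of_bits s').*2 + (nat_of_bool b).+1)%N else 0%N.

(* The graph of a partial function on binary strings: [M p s] means that [M]
   halts on the program [p] with output [s]. *)
Definition machine := seq bool -> seq bool -> Prop.

Definition computable_machine (M : machine) : Prop :=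
  exists2 f : pfun 1, partial_recursive f &
    forall p s, M p s <-> f [tuple nat_of_bits p] (nat_of_bits s).

Definition prefix_free (M : machine) : Prop :=
  forall p q s t, M p s -> M q t -> prefix p q -> p = q.

Definition prefix_machine (M : machine) : Prop :=
  computable_machine M /\ prefix_free M.

(* The least length of a program for [s]; +oo if there is none. *)
Definition complexity (R : realType) (M : machine) (s : seq bool) : \bar R :=
  ereal_inf [set ((size p)%:R)%:E | p in [set p | M p s]].

(* Prefix-free Kolmogorov complexity K is [complexity R U] for an arbitrary
   such [U]; any two choices of [U] give the same K up to O(1). *)
Definition universal_prefix_machine (R : realType) (U : machine) : Prop :=
  prefix_machine U /\
  forall M : machine, prefix_machine M -> exists c : nat, forall s : seq bool,
    (complexity R U s <= complexity R M s + c%:R%:E)%E.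

(** ** Complex oscillations

    Elements of C[0,1] are represented by functions on [R], of which only the
    values on [0,1] matter. *)

Section ComplexOscillation.
Variable R : realType.
Implicit Types (x omega : R -> R) (n : nat).

Definition C01 x : Prop := {within `[0, 1], continuous x}.

Definition unorm x : R := sup [set `|x t| | t in `[0, 1]].

(* The [i]-th subinterval, with [i] counted from 0. *)
Definition subinterval n (i : nat) : set R := `[i%:R / n%:R, i.+1%:R / n%:R].

Definition linear_with_slope x (a : R) (I : set R) : Prop :=
  exists b : R, forall t, I t -> x t = a * t + b.

Definition Cn n x : Prop :=
  [/\ C01 x, x 0 = 0 &
      forall i : nat, (i < n)%N ->
        linear_with_slope x (Num.sqrt n%:R) (subinterval n i) \/
        linear_with_slope x (- Num.sqrt n%:R) (subinterval n i)].

Definition increasing_on x (I : set R) : Prop :=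
  forall s t, I s -> I t -> s < t -> x s < x t.

(* The bit [true] stands for 1 and [false] for -1. *)
Definition slope_code n x : seq bool :=
  mkseq (fun i => `[< increasing_on x (subinterval n i) >]) n.

Definition complex_sequence (U : machine) (x_ : nat -> R -> R) : Prop :=
  (forall n, (0 < n)%N -> Cn n (x_ n)) /\
  exists d : nat, forall n, (0 < n)%N ->
    ((n%:R - d%:R)%:E <= complexity R U (slope_code n (x_ n)))%E.

Definition converges_effectively (x_ : nat -> R -> R) x : Prop :=
  exists2 psi : nat -> nat, computable_fun psi &
    forall k n, (0 < n)%N -> (psi k <= n)%N ->
      unorm (fun t => x_ n t - x t) <= 2^-1 ^+ k.

Definition complex_oscillation (U : machine) omega : Prop :=
  C01 omega /\
  exists2 x_ : nat -> R -> R,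
    complex_sequence U x_ & converges_effectively x_ omega.

(* The increments h allowed in the limsup at t: h tends to 0, h != 0 and
   t + h in [0,1]. *)
Definition increments (t : R) : set_system R :=
  within [set h | t + h \in `[0, 1]%R] 0^'.

Definition lil_ratio omega (t h : R) : R :=
  `|omega (t + h) - omega t| / Num.sqrt (2 * `|h| * ln (ln (1 / `|h|))).

End ComplexOscillation.

(* Main.v *)
Require Import Defs.
From mathcomp Require Import all_boot all_order all_algebra.
From mathcomp Require Import all_classical all_reals all_analysis.
From mathcomp Require Import zify ring lra.

Import Order.TTheory GRing.Theory Num.Theory.
Import numFieldNormedType.Exports.

Local Open Scope classical_set_scope.
Local Open Scope ring_scope.

(** Group the increments h into windows
    2^-w(k+1) <= |h| <= 2^-w(k) with w(k) = 2^(C k), on which log log (1/|h|)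
    is C k log 2 up to a factor tending to 1.  For a simple random walk with
    enough steps, the probability that some increment from a given time in
    window k is too large (by Ville's inequality for a mixture of exponential
    supermartingales), or that none is large (by independence over disjoint
    blocks and a tilting lower bound for the tail), is at most 2^-(3k+1) for
    large k.  So the strings for which a proportion 2^-k of the starting times
    is bad have probability at most 2^-(2k+1).  These sets are decidable
    uniformly in k, the length N(k) of the strings being computable from the
    modulus of convergence, so the k-th one can be coded by 1^k 0 followed by
    a rank, k bits shorter than the string itself.  Hence the codes of a
    complex sequence lie in only finitely many of them, and the Borel-Cantelli
    lemma on [0,1] shows that almost every t is eventually good. *)

(** * Recursive functions *)

(** Each window is judged on a single walk of length N(k), so one value of the modulus per window
    suffices. Decidability forces integer arithmetic: squared displacements are compared with
    [a * k] times the elapsed steps, where the integer [a] stands for 2 C log 2 up to the factor (1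
    + de)^2 or (1 - de)^2, and only countably many de are used. The exponent 3k+1 is a budget:
    Markov's inequality spends k on passing from one starting time to a proportion 2^-k of them; the
    remaining 2k+1 shorten the rank, k+1 of these pay for the header 1^k 0, and the last k beat the
    constant of the universal machine. Windows must be that wide for the constant to come out as 1.
    A window holds about 2^(C k) scales, so the probability at one scale should be near 2^-(C k).
    From above, the union over scales and the budget cost a further 2^-(4k), which raises [a] by an
    amount independent of C and is negligible once C is large. From below, a level slightly under
    the critical one is reached at a single scale with probability much larger than k 2^-(C k), and
    2^(C k) nearly independent attempts make failure as rare as the budget demands. *)

Section RecursiveFunctions.
Local Open Scope nat_scope.

(* [F] reads its arguments from an environment [nat -> nat], of which only the
   first [k] entries are given; a bound variable is pushed as entry [0]. *)
Definition recursive k (F : (nat -> nat) -> nat) : Prop :=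
  partial_recursive (fun (v : k.-tuple nat) y => y = F (nth 0 v)).

Lemma partial_recursive_ext k (f g : pfun k) :
  (forall v y, f v y <-> g v y) -> partial_recursive f -> partial_recursive g.
Proof.
move=> fg; suff -> : f = g by [].
by apply/funext => v; apply/funext => y; apply/propext.
Qed.

Lemma recursive_comp k F (Gs : seq ((nat -> nat) -> nat)) :
  recursive (size Gs) F -> (forall i, i < size Gs -> recursive k (nth (fun=> 0) Gs i)) ->
  recursive k (fun e => F (nth 0 [seq G e | G <- Gs])).
Proof.
move=> rF rG.
have := PRcomp rF (fun i : 'I_(size Gs) => rG i (ltn_ord i)).
apply: partial_recursive_ext => v y; split.
  case=> w wE ->; congr F; apply/funext => i.
  have -> : [seq G (nth 0 v) | G <- Gs] = w; last by [].
  apply: (@eq_from_nth _ 0); rewrite size_map ?size_tuple// => j jG.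
  by rewrite (nth_map (fun=> 0))// -[j in LHS]/(nat_of_ord (Ordinal jG)) -wE (tnth_nth 0).
move=> ->; exists (map_tuple (fun G => G (nth 0 v)) (in_tuple Gs)) => //.
by move=> i; rewrite tnth_map (tnth_nth (fun=> 0)).
Qed.

Lemma recursive_var k i : i < k -> recursive k (fun e => e i).
Proof.
move=> ik; apply: partial_recursive_ext (PRproj (Ordinal ik)) => v y.
by rewrite (tnth_nth 0).
Qed.

Lemma recursive0 k : recursive k (fun=> 0).
Proof. exact: PRzero. Qed.

Lemma recursive_fun (phi : nat -> nat) k F :
  computable_fun phi -> recursive k F -> recursive k (fun e => phi (F e)).
Proof.
move=> cphi rF; apply: (@recursive_comp k (fun e => phi (e 0)) [:: F]) => [|[]//].
by apply: partial_recursive_ext cphi => v y; case/tupleP: v => a v.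
Qed.

Lemma recursiveS k F : recursive k F -> recursive k (fun e => (F e).+1).
Proof. exact: (@recursive_fun succn _ _ PRsucc). Qed.

Lemma recursive_const k c : recursive k (fun=> c).
Proof. by elim: c => [|c IH]; [exact: recursive0|exact: recursiveS]. Qed.

Lemma recursive_ext k F G :
  (forall v : k.-tuple nat, F (nth 0 v) = G (nth 0 v)) ->
  recursive k F -> recursive k G.
Proof. by move=> FG; apply: partial_recursive_ext => v y; rewrite FG. Qed.

(** The condition is an equivalence because entries beyond the arity read as 0: the renaming has to
    send them beyond the new arity. *)
Lemma recursive_rename k l F (r : nat -> nat) :
  (forall i, (r i < l) = (i < k)) -> recursive k F ->
  recursive l (fun e => F (fun i => e (r i))).
Proof.
move=> rE rF; pose Gs : seq ((nat -> nat) -> nat) := mkseq (fun i e => e (r i)) k.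
have sGs : size Gs = k by rewrite size_mkseq.
apply: recursive_ext (@recursive_comp l F Gs _ _).
- move=> v; congr F; apply/funext => i.
  rewrite -map_comp -[X in nth _ X]/(mkseq (fun i => nth 0 v (r i)) k).
  have [ik|ki] := ltnP i k; first by rewrite nth_mkseq.
  by rewrite !nth_default ?size_mkseq ?size_tuple// leqNgt rE -leqNgt.
- by rewrite sGs.
- by rewrite sGs => i ik; rewrite nth_mkseq//; apply: recursive_var; rewrite rE.
Qed.

(** In the step function, entry 0 is the counter, entry 1 the value so far, and the environment
    follows, shifted by 2. The bound [B] is substituted for the counter at the end. *)
Lemma recursive_prim k (F : nat -> (nat -> nat) -> nat) B f g :
  (forall e, F 0 e = f e) -> (forall n e, F n.+1 e = g n (F n e) e) ->
  recursive k B -> recursive k f ->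
  recursive k.+2 (fun e => g (e 0) (e 1) (fun i => e i.+2)) ->
  recursive k (fun e => F (B e) e).
Proof.
move=> F0 FS rB rf rg.
have rF : recursive k.+1 (fun e => F (e 0) (fun i => e i.+1)).
  apply: partial_recursive_ext (PRprec rf rg) => v y; case/tupleP: v => n v.
  have tE : nth 0 [tuple of behead [tuple of n :: v]] = nth 0 v by [].
  have tE2 a b : (fun i => nth 0 [tuple of a :: b :: behead [tuple of n :: v]] i.+2) = nth 0 v by [].
  rewrite /pprec theadE /=; split.
    case=> s [s0 sS ->].
    suff H i : i <= n -> s i = F i (nth 0 v) by rewrite H.
    elim: i => [_|i IH ilt]; first by rewrite s0 F0.
    by rewrite sS// IH// ?FS// ltnW.
  by move=> ->; exists (fun i => F i (nth 0 v)); split.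
pose Gs : seq ((nat -> nat) -> nat) := B :: mkseq (fun i e => e i) k.
have sGs : size Gs = k.+1 by rewrite /= size_mkseq.
apply: recursive_ext (@recursive_comp k (fun e => F (e 0) (fun i => e i.+1)) Gs _ _).
- move=> v /=; congr F; apply/funext => i.
  rewrite -map_comp -[X in nth _ X]/(mkseq (nth 0 v) k).
  by rewrite -{2}(size_tuple v) mkseq_nth.
- by rewrite sGs.
- rewrite sGs => -[_|i ik] //=.
  by rewrite nth_mkseq//; apply: recursive_var.
Qed.

Lemma recursive_shift k F : recursive k F -> recursive k.+1 (fun e => F (fun i => e i.+1)).
Proof. by apply: recursive_rename. Qed.

Lemma recursive_shift2 k F : recursive k F -> recursive k.+2 (fun e => F (fun i => e i.+2)).
Proof. by apply: recursive_rename. Qed.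

Lemma recursiveD k F G : recursive k F -> recursive k G ->
  recursive k (fun e => F e + G e).
Proof.
move=> rF rG.
apply: (@recursive_prim _ (fun n e => n + G e) F G (fun _ a _ => a.+1)) => //.
exact/recursiveS/recursive_var.
Qed.

Lemma recursiveM k F G : recursive k F -> recursive k G ->
  recursive k (fun e => F e * G e).
Proof.
move=> rF rG.
apply: (@recursive_prim _ (fun n e => n * G e) F (fun=> 0)
  (fun _ a e => G e + a)) => //.
  exact: recursive0.
by apply: recursiveD; [exact: recursive_shift2|exact: recursive_var].
Qed.

Lemma recursiveX k F G : recursive k F -> recursive k G ->
  recursive k (fun e => F e ^ G e).
Proof.
move=> rF rG.
apply: (@recursive_prim _ (fun n e => F e ^ n) G (fun=> 1)
  (fun _ a e => F e * a)) => // [n e||]; first by rewrite expnS.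
  exact: recursive_const.
by apply: recursiveM; [exact: recursive_shift2|exact: recursive_var].
Qed.

Lemma recursiveB k F G : recursive k F -> recursive k G ->
  recursive k (fun e => F e - G e).
Proof.
move=> rF rG.
apply: (@recursive_prim _ (fun n e => F e - n) G F (fun _ a _ => a.-1)) => //.
- by move=> e; rewrite subn0.
- by move=> n e; rewrite subnS.
apply: (@recursive_prim _ (fun n _ => n.-1) (fun e => e 1) (fun=> 0) (fun n _ _ => n)) => //.
- exact: recursive_var.
- exact: recursive0.
- exact: recursive_var.
Qed.

Lemma recursive_leq k F G : recursive k F -> recursive k G ->
  recursive k (fun e => nat_of_bool (F e <= G e)).
Proof.
move=> rF rG.
have -> : (fun e => nat_of_bool (F e <= G e)) = (fun e => 1 - (F e - G e)).
  by apply/funext => e; rewrite /leq; case: (F e - G e).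
by apply: recursiveB; [exact: recursive_const|exact: recursiveB].
Qed.

Lemma recursive_and k P Q : recursive k (fun e => nat_of_bool (P e)) ->
  recursive k (fun e => nat_of_bool (Q e)) -> recursive k (fun e => nat_of_bool (P e && Q e)).
Proof.
move=> rP rQ; have -> : (fun e => nat_of_bool (P e && Q e)) = (fun e => P e * Q e).
  by apply/funext => e; rewrite mulnb.
exact: recursiveM.
Qed.

Lemma recursive_neg k P : recursive k (fun e => nat_of_bool (P e)) ->
  recursive k (fun e => nat_of_bool (~~ P e)).
Proof.
move=> rP; have -> : (fun e => nat_of_bool (~~ P e)) = (fun e => 1 - P e).
  by apply/funext => e; case: (P e).
by apply: recursiveB rP; exact: recursive_const.
Qed.

Lemma recursive_eq k F G : recursive k F -> recursive k G ->
  recursive k (fun e => nat_of_bool (F e == G e)).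
Proof.
move=> rF rG; under eq_fun do rewrite eqn_leq.
by apply: recursive_and; exact: recursive_leq.
Qed.

Lemma recursive_sum k B (F : nat -> (nat -> nat) -> nat) : recursive k B ->
  recursive k.+1 (fun e => F (e 0) (fun i => e i.+1)) ->
  recursive k (fun e => \sum_(i < B e) F i e).
Proof.
move=> rB rF.
apply: (@recursive_prim _ (fun n e => \sum_(i < n) F i e) B (fun=> 0)
  (fun n a e => a + F n e)) => //.
- by move=> e; rewrite big_ord0.
- by move=> n e; rewrite big_ord_recr.
- exact: recursive0.
apply: recursiveD; first exact: recursive_var.
(* The summand keeps the counter in entry 0 and skips the accumulator in entry 1. *)
apply: (@recursive_rename k.+1 k.+2 (fun e => F (e 0) (fun i => e i.+1))
  (fun i => if i is j.+1 then j.+2 else 0)) rF.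
by case.
Qed.

Lemma recursive_exists k B (P : nat -> (nat -> nat) -> bool) : recursive k B ->
  recursive k.+1 (fun e => nat_of_bool (P (e 0) (fun i => e i.+1))) ->
  recursive k (fun e => nat_of_bool [exists i : 'I_(B e), P i e]).
Proof.
move=> rB rP.
have -> : (fun e => nat_of_bool [exists i : 'I_(B e), P i e]) =
    (fun e => nat_of_bool (1 <= \sum_(i < B e) P i e)).
  apply/funext => e; congr nat_of_bool.
  rewrite lt0n sum_nat_eq0 negb_forall; apply: eq_existsb => i.
  by case: (P i e).
apply: recursive_leq; first exact: recursive_const.
exact: (@recursive_sum _ _ (fun i e => nat_of_bool (P i e))).
Qed.

Lemma recursive_forall k B (P : nat -> (nat -> nat) -> bool) : recursive k B ->
  recursive k.+1 (fun e => nat_of_bool (P (e 0) (fun i => e i.+1))) ->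
  recursive k (fun e => nat_of_bool [forall i : 'I_(B e), P i e]).
Proof.
move=> rB rP.
have -> : (fun e => nat_of_bool [forall i : 'I_(B e), P i e]) =
    (fun e => nat_of_bool (~~ [exists i : 'I_(B e), ~~ P i e])).
  by apply/funext => e; rewrite negb_exists; under eq_forallb do rewrite negbK.
by apply: recursive_neg; apply: (@recursive_exists _ _ (fun i e => ~~ P i e)) => //;
  apply: recursive_neg.
Qed.

Lemma recursive_div k F G : recursive k F -> recursive k G ->
  recursive k (fun e => F e %/ G e).
Proof.
move=> rF rG.
(* The quotient counts the positive multiples of [G e] up to [F e]; the factor [0 < G e] encodes
   that division by 0 gives 0. *)
have -> : (fun e => F e %/ G e) =
    (fun e => (0 < G e) * \sum_(i < F e) (i.+1 * G e <= F e)).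
  apply/funext => e; case: (posnP (G e)) => [->|G0]; first by rewrite divn0.
  rewrite mul1n; under eq_bigr do rewrite -leq_divRL//.
  suff sE n q : \sum_(i < n) (i < q) = minn n q by rewrite sE (minn_idPr (leq_div _ _)).
  elim: n => [|n IH]; first by rewrite big_ord0 min0n.
  by rewrite big_ord_recr /= IH; lia.
apply: recursiveM; first by apply: recursive_leq => //; exact: recursive_const.
apply: (@recursive_sum _ _ (fun i e => i.+1 * G e <= F e)) => //.
apply: recursive_leq; last exact: recursive_shift.
by apply: recursiveM; [exact/recursiveS/recursive_var|exact: recursive_shift].
Qed.

Lemma recursive_mod k F G : recursive k F -> recursive k G ->
  recursive k (fun e => F e %% G e).
Proof.
move=> rF rG.
have -> : (fun e => F e %% G e) = (fun e => F e - F e %/ G e * G e).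
  by apply/funext => e; rewrite {2}(divn_eq (F e) (G e)) addKn.
by apply: recursiveB => //; apply: recursiveM => //; apply: recursive_div.
Qed.

End RecursiveFunctions.

(** * A prefix-free machine coding effectively small sets *)

Section TestMachine.
Local Open Scope nat_scope.

(** The successor of [nat_of_bits s] has as binary digits, lowest first, the bits of [s] followed by
    a leading 1. All the arithmetic of codes rests on this. *)
Lemma nat_of_bits_cons b s :
  (nat_of_bits (b :: s)).+1 = 2 * (nat_of_bits s).+1 + b.
Proof. by rewrite /=; lia. Qed.

Lemma nat_of_bits_bounds s :
  2 ^ size s <= (nat_of_bits s).+1 < 2 ^ (size s).+1.
Proof.
elim: s => [//|b s IH]; rewrite nat_of_bits_cons [size _]/= 2!expnS.
by move: IH; rewrite expnS; case: b => /=; lia.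
Qed.

Lemma nat_of_bits_inj : injective nat_of_bits.
Proof.
elim=> [|b s IH] [|c t]//= st; try lia.
have : nat_of_bits s = nat_of_bits t by case: b c st => -[] /=; lia.
by move=> /IH ->; congr cons; case: b c st => -[] //=; lia.
Qed.

Lemma nat_of_bits_surj y : exists s, nat_of_bits s = y.
Proof.
have [n] := ubnP y; elim: n y => // n IH [_|y yn]; first by exists [::].
have [s sE] := IH (y./2) ltac:(lia).
by exists (odd y :: s); rewrite /= sE; lia.
Qed.

(** Adding 2 instead of 1 turns the run of [true]s into a power of 2, so [k] is the 2-adic valuation
    and [w] is read off from the odd part. *)
Lemma nat_of_bits_nseq k w :
  (nat_of_bits (nseq k true ++ false :: w)).+2 =
  2 ^ k * (2 * (nat_of_bits w).+1).+1.
Proof.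
elim: k => [|k IH]; first by rewrite -[LHS]/((nat_of_bits (false :: w)).+1.+1) nat_of_bits_cons; lia.
have -> : nseq k.+1 true ++ false :: w = true :: (nseq k true ++ false :: w) by [].
by rewrite -[LHS]/((nat_of_bits (true :: _)).+1.+1) nat_of_bits_cons expnS -mulnA -IH; lia.
Qed.

Lemma size_of_nat_of_bits l s :
  2 ^ l <= (nat_of_bits s).+1 < 2 ^ l.+1 -> size s = l.
Proof.
have /andP[s1 s2] := nat_of_bits_bounds s => /andP[l1 l2].
have := leq_ltn_trans l1 s2; have := leq_ltn_trans s1 l2.
by rewrite !ltn_exp2l// !ltnS => ? ?; apply/eqP; rewrite eqn_leq; apply/andP.
Qed.

Section Test.
Variables (N : nat -> nat) (A : nat -> nat -> bool).
Hypothesis cN : computable_fun N.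
Hypothesis rA : recursive 2 (fun e => nat_of_bool (A (e 0) (e 1))).

(** The inequalities say that [y] codes a string of length [N k]. *)
Definition member k y := (2 ^ N k <= y.+1 < 2 ^ (N k).+1) && A k y.

Definition rank k y := \sum_(z < y) member k z.

Definition code_length k := N k - (2 * k).+1.

Definition accept p y := [exists k : 'I_p.+1,
  [&& member k y, rank k y < 2 ^ code_length k &
   p.+2 == 2 ^ k * (2 * (2 ^ code_length k + rank k y)).+1]].

(* An element of the [k]-th set is coded by [1^k 0] followed by its rank,
   written with [code_length k] bits. *)
Definition test_machine (p s : seq bool) : Prop :=
  accept (nat_of_bits p) (nat_of_bits s).

Let recursive_member k F G : recursive k F -> recursive k G ->
  recursive k (fun e => nat_of_bool (member (F e) (G e))).
Proof.
move=> rF rG; have rN : recursive k (fun e => N (F e)) by apply: recursive_fun.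
apply: recursive_and; last first.
  apply: (@recursive_comp k (fun e => nat_of_bool (A (e 0) (e 1))) [:: F; G]) => //.
  by move=> [|[|]].
have rX G' : recursive k G' -> recursive k (fun e => 2 ^ G' e).
  by apply: recursiveX; exact: recursive_const.
apply: recursive_and; apply: recursive_leq.
- exact: rX.
- exact: recursiveS.
- by do 2 apply: recursiveS.
- by apply/rX/recursiveS.
Qed.

Let recursive_rank k F G : recursive k F -> recursive k G ->
  recursive k (fun e => rank (F e) (G e)).
Proof.
move=> rF rG; apply: (@recursive_sum _ _ (fun z e => nat_of_bool (member (F e) z))) => //.
by apply: recursive_member; [exact: recursive_shift|exact: recursive_var].
Qed.

Let recursive_code_length k F : recursive k F -> recursive k (fun e => code_length (F e)).
Proof.
move=> rF; apply: recursiveB; first exact: recursive_fun.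
by apply/recursiveS/recursiveM => //; exact: recursive_const.
Qed.

Lemma recursive_accept : recursive 2 (fun e => nat_of_bool (accept (e 1) (e 0))).
Proof.
apply: (@recursive_exists _ _ (fun k e => [&& member k (e 0), rank k (e 0) < 2 ^ code_length k &
   (e 1).+2 == 2 ^ k * (2 * (2 ^ code_length k + rank k (e 0))).+1])).
  exact/recursiveS/recursive_var.
have v0 : recursive 3 (fun e => e 0) by exact: recursive_var.
have v1 : recursive 3 (fun e => e 1) by exact: recursive_var.
have v2 : recursive 3 (fun e => e 2) by exact: recursive_var.
have rr : recursive 3 (fun e => rank (e 0) (e 1)) by exact: recursive_rank.
have rX k F : recursive k F -> recursive k (fun e => 2 ^ F e).
  by apply: recursiveX; exact: recursive_const.
have rl : recursive 3 (fun e => 2 ^ code_length (e 0)) by apply/rX/recursive_code_length.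
apply: recursive_and; first exact: recursive_member.
apply: recursive_and; first by apply: recursive_leq => //; exact: recursiveS.
apply: recursive_eq; first by do 2 apply: recursiveS.
apply: recursiveM; first exact: rX.
apply/recursiveS/recursiveM; first exact: recursive_const.
exact: recursiveD.
Qed.

Lemma rank_lt k y z : member k y -> y < z -> rank k y < rank k z.
Proof.
move=> my /subnKC <-; rewrite /rank big_split_ord /= big_ord_recr /= my; lia.
Qed.

Lemma rank_inj k y z : member k y -> member k z -> rank k y = rank k z -> y = z.
Proof.
move=> my mz rE; case: (ltngtP y z) => // yz.
  by have := rank_lt _ _ _ my yz; rewrite rE ltnn.
by have := rank_lt _ _ _ mz yz; rewrite rE ltnn.
Qed.

Lemma two_adic k l a b : 2 ^ k * (2 * a).+1 = 2 ^ l * (2 * b).+1 -> k = l /\ a = b.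
Proof.
move=> E; have v i c : logn 2 (2 ^ i * (2 * c).+1) = i.
  rewrite lognM ?expn_gt0// lognX logn_prime// muln1 lognE /=.
  by rewrite dvdn2 /= oddM /= addn0.
have kl : k = l by rewrite -(v k a) E v.
split=> //; move: E; rewrite kl => /eqP.
by rewrite eqn_pmul2l ?expn_gt0// => /eqP; lia.
Qed.

Lemma accept_fun p y z : accept p y -> accept p z -> y = z.
Proof.
move=> /existsP[k /and3P[my _ /eqP kE]] /existsP[l /and3P[mz _ /eqP lE]].
have [kl] := two_adic _ _ _ _ (etrans (esym kE) lE).
rewrite -kl => /addnI; rewrite -kl in mz; exact: rank_inj.
Qed.

Lemma accept_shape p y : accept (nat_of_bits p) y ->
  exists k w, p = nseq k true ++ false :: w /\ size w = code_length k.
Proof.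
move=> /existsP[k /and3P[my rk /eqP kE]].
have [w wE] := nat_of_bits_surj (2 ^ code_length k + rank k y).-1.
have wE1 : (nat_of_bits w).+1 = 2 ^ code_length k + rank k y.
  by rewrite wE prednK// ltn_addr// expn_gt0.
exists k, w; split; last first.
  by apply: size_of_nat_of_bits; rewrite wE1 expnS; lia.
apply: nat_of_bits_inj; apply/eqP; rewrite -2!eqSS.
by rewrite nat_of_bits_nseq wE1 -kE.
Qed.

Lemma prefix_code k l (v w : seq bool) :
  prefix (nseq k true ++ false :: v) (nseq l true ++ false :: w) ->
  k = l /\ prefix v w.
Proof. by elim: k l => [|k IH] [|l] //= /IH[-> ?]. Qed.

Lemma prefix_machine_test : prefix_machine test_machine.
Proof.
split; last first.
  move=> p q s t /accept_shape[k [v [-> vk]]] /accept_shape[l [w [-> wl]]].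
  move=> /prefix_code[kl]; rewrite kl in vk *.
  by rewrite prefixE -wl in vk *; rewrite vk take_size => /eqP ->.
(* The output is found by unbounded search: the least accepted [y] is the only one, by [accept_fun].
   The negation makes acceptance the value 0 that [pmin] looks for. *)
exists (pmin (fun (v : 2.-tuple nat) y => y = ~~ accept (nth 0 v 1) (nth 0 v 0))).
  apply: PRmin.
  exact: (@recursive_neg 2 (fun e => accept (e 1) (e 0)) recursive_accept).
move=> p s; rewrite /test_machine /pmin /=; split=> [a|[]].
  split; first by rewrite a.
  move=> i ilt; exists 0; case: (boolP (accept _ _)) => // /accept_fun /(_ a) E.
  by rewrite E ltnn in ilt.
by case: (accept _ _).
Qed.

(** The header takes k+1 bits and the rank N k - (2k+1), hence N k - k in all. The rank at
    [2 ^ (N k).+1] is the cardinality of the [k]-th set. *)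
Lemma test_machine_program k s :
  rank k (2 ^ (N k).+1) * 2 ^ (2 * k).+1 <= 2 ^ N k ->
  size s = N k -> A k (nat_of_bits s) ->
  exists2 p, test_machine p s & size p + k = N k.
Proof.
move=> few sN As; have ms : member k (nat_of_bits s).
  by rewrite /member As -sN nat_of_bits_bounds.
set y := nat_of_bits s in ms *.
have /andP[/andP[_ /ltnW y2] _] := ms.
have {}few : (rank k y).+1 * 2 ^ (2 * k).+1 <= 2 ^ N k.
  by apply: leq_trans few; rewrite leq_mul2r; apply/orP; right; exact: rank_lt.
have kN : (2 * k).+1 <= N k.
  by rewrite -(@leq_exp2l 2)//; apply: leq_trans few; rewrite leq_pmull.
have rk : rank k y < 2 ^ code_length k.
  by rewrite -(@leq_pmul2r (2 ^ (2 * k).+1)) ?expn_gt0// -expnD subnK.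
have [w wE] := nat_of_bits_surj (2 ^ code_length k + rank k y).-1.
have wE1 : (nat_of_bits w).+1 = 2 ^ code_length k + rank k y.
  by rewrite wE prednK// ltn_addr// expn_gt0.
exists (nseq k true ++ false :: w); last first.
  rewrite size_cat size_nseq /= (@size_of_nat_of_bits (code_length k) w); last first.
    by rewrite wE1 expnS; lia.
  by rewrite /code_length; lia.
have E := nat_of_bits_nseq k w.
have klt : k < (nat_of_bits (nseq k true ++ false :: w)).+1.
  rewrite -2!ltnS E; have := ltn_expl k (isT : 1 < 2).
  move=> k2; rewrite ltnS; apply: (@leq_trans (2 ^ k * 3)); first by lia.
  by rewrite leq_mul2l; lia.
apply/existsP; exists (Ordinal klt) => /=.
by rewrite ms rk E wE1 eqxx.
Qed.

End Test.

End TestMachine.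

(** A single machine serves all [k], so its universality constant [c] is fixed, and saving k > c + d
    bits contradicts the lower bound on complexity. *)
Lemma effective_borel_cantelli (R : realType) (U : machine) (N : nat -> nat)
    (A : nat -> nat -> bool) (s_ : nat -> seq bool) (d : nat) :
  universal_prefix_machine R U ->
  computable_fun N -> (forall k, 0 < N k)%N ->
  recursive 2 (fun e => nat_of_bool (A (e 0%N) (e 1%N))) ->
  (forall n, size (s_ n) = n) ->
  (forall n, (0 < n)%N -> ((n%:R - d%:R)%:E <= complexity R U (s_ n))%E) ->
  exists K, forall k, (K <= k)%N ->
    (rank N A k (2 ^ (N k).+1) * 2 ^ (2 * k).+1 <= 2 ^ N k)%N ->
    ~~ A k (nat_of_bits (s_ (N k))).
Proof.
move=> [pU univ] cN N0 rA ss cs.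
have [c Uc] := univ _ (prefix_machine_test _ _ cN rA).
exists (c + d).+1 => k cdk few; apply/negP => As.
have [p Mp sp] := test_machine_program _ _ _ _ few (ss _) As.
have : (complexity R (test_machine N A) (s_ (N k)) <= (size p)%:R%:E)%E.
  by apply: ereal_inf_lbound; exists p.
have := cs _ (N0 k); have := Uc (s_ (N k)).
move=> h1 h2 h3; have : (((N k)%:R - d%:R : R)%:E <= (size p)%:R%:E + c%:R%:E)%E.
  by apply: le_trans h2 _; apply: le_trans h1 _; rewrite leeD2r.
rewrite -EFinD lee_fin lerBlDr -!natrD ler_nat; lia.
Qed.

(** * Coin tossing *)

Section CoinTossing.
Variable R : realType.
Implicit Types (f g : seq bool -> R) (n m : nat).

(* Expectation of [f] under the uniform distribution on strings of length [n]. *)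
Fixpoint Ex n f : R :=
  if n is m.+1 then
    (Ex m (fun s => f (true :: s)) + Ex m (fun s => f (false :: s))) / 2
  else f [::].

Lemma Ex_le n f g : (forall s, size s = n -> f s <= g s) -> Ex n f <= Ex n g.
Proof.
elim: n f g => [|n IH] f g fg /=; first exact: fg.
rewrite ler_pM2r ?invr_gt0//; apply: lerD; apply: IH => s sn; apply: fg => /=; lia.
Qed.

Lemma Ex_ext n f g : (forall s, size s = n -> f s = g s) -> Ex n f = Ex n g.
Proof. by move=> fg; apply/eqP; rewrite eq_le !Ex_le// => s /fg ->. Qed.

Lemma Ex_cst n (c : R) : Ex n (fun=> c) = c.
Proof. by elim: n => //= n ->; field. Qed.

Lemma ExD n f g : Ex n (fun s => f s + g s) = Ex n f + Ex n g.
Proof. by elim: n f g => //= n IH f g; rewrite !IH; field. Qed.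

Lemma ExZ n (c : R) f : Ex n (fun s => c * f s) = c * Ex n f.
Proof. by elim: n f => //= n IH f; rewrite !IH; field. Qed.

Lemma Ex_sum n k (F : nat -> seq bool -> R) :
  Ex n (fun s => \sum_(i < k) F i s) = \sum_(i < k) Ex n (F i).
Proof.
elim: k => [|k IH].
  by under Ex_ext do rewrite big_ord0; rewrite big_ord0 Ex_cst.
by rewrite big_ord_recr /= -IH -ExD; apply: Ex_ext => s _; rewrite big_ord_recr.
Qed.

Lemma Ex_cat n m f :
  Ex (n + m) f = Ex n (fun u => Ex m (fun v => f (u ++ v))).
Proof. by elim: n f => //= n IH f; rewrite !IH. Qed.

Lemma Ex_rev n f : Ex n (fun s => f (rev s)) = Ex n f.
Proof.
elim: n f => // n IH f.
have E b : Ex n (fun s => f (rev (b :: s))) = Ex n (fun s => f (s ++ [:: b])).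
  by rewrite -(IH (fun s => f (s ++ [:: b]))); apply: Ex_ext => s _; rewrite rev_cons -cats1.
rewrite -[in RHS]addn1 Ex_cat [LHS]/= !E -ExD mulrC -ExZ.
by apply: Ex_ext => s _ /=; rewrite mulrC.
Qed.

Lemma Ex_neg n f : Ex n (fun s => f (map negb s)) = Ex n f.
Proof.
elim: n f => // n IH f /=.
by rewrite (IH (fun s => f (false :: s))) (IH (fun s => f (true :: s))) addrC.
Qed.

Lemma Ex_take n m f : (m <= n)%N -> Ex n (fun s => f (take m s)) = Ex m f.
Proof.
move=> mn; rewrite -{1}(subnKC mn) Ex_cat; apply: Ex_ext => s sm.
by under Ex_ext do rewrite take_size_cat//; rewrite Ex_cst.
Qed.

Lemma Ex_drop n m f : (m <= n)%N -> Ex n (fun s => f (drop m s)) = Ex (n - m) f.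
Proof.
move=> mn; rewrite -{1}(subnKC mn) Ex_cat -[RHS](Ex_cst m); apply: Ex_ext => s sm.
by apply: Ex_ext => t _; rewrite drop_size_cat.
Qed.

(** The first bit of a string is the lowest digit of its code, so the recursion of [Ex] splits the
    sum into odd and even indices. *)
Lemma sum_nat_of_bits n (h : nat -> R) :
  \sum_(x < 2 ^ n) h (2 ^ n + x)%N = (2 ^ n)%:R * Ex n (fun s => h (nat_of_bits s).+1).
Proof.
elim: n h => [|n IH] h; first by rewrite expn0 big_ord_recl big_ord0 /= addr0 mul1r.
have -> : Ex n.+1 (fun s => h (nat_of_bits s).+1) =
    (Ex n (fun s => h (2 * (nat_of_bits s).+1 + 1)%N) +
     Ex n (fun s => h (2 * (nat_of_bits s).+1)%N)) / 2.
  congr ((_ + _) / 2); apply: Ex_ext => s _; first by rewrite nat_of_bits_cons.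
  by rewrite nat_of_bits_cons addn0.
have sum2 m (h' : nat -> R) :
    \sum_(x < 2 * m) h' x = \sum_(x < m) h' (2 * x + 1)%N + \sum_(x < m) h' (2 * x)%N.
  elim: m => [|m IHm]; first by rewrite muln0 !big_ord0 addr0.
  have -> : (2 * m.+1 = (2 * m).+2)%N by lia.
  by rewrite !big_ord_recr /= IHm addn1; lra.
rewrite expnS (sum2 _ (fun x => h (2 * 2 ^ n + x)%N)) natrM.
under eq_bigr do rewrite addnA -mulnDr.
under [X in _ + X]eq_bigr do rewrite -mulnDr.
rewrite (IH (fun x => h (2 * x + 1)%N)) (IH (fun x => h (2 * x)%N)).
by field.
Qed.

Lemma sum_member (N : nat -> nat) (A : nat -> nat -> bool) k :
  (rank N A k (2 ^ (N k).+1))%:R =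
  (2 ^ N k)%:R * Ex (N k) (fun s => (A k (nat_of_bits s))%:R) :> R.
Proof.
rewrite -(sum_nat_of_bits (N k) (fun x => (A k x.-1)%:R)) /rank natr_sum.
set n := N k; have n0 : (0 < 2 ^ n)%N by rewrite expn_gt0.
(* Codes of strings of length n fill the 2^n integers from 2^n - 1 on; the ones below and the single
   last one contribute 0. *)
have E : ((2 ^ n.+1) = (2 ^ n).-1 + 2 ^ n + 1)%N by rewrite expnS; lia.
rewrite -(big_mkord xpredT (fun z => (member N A k z)%:R : R)) E.
have m0 z : (z < (2 ^ n).-1)%N -> member N A k z = false.
  by move=> zn; rewrite /member -/n; apply/negbTE; lia.
have m1 : member N A k ((2 ^ n).-1 + 2 ^ n)%N = false.
  by rewrite /member -/n expnS; apply/negbTE; lia.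
rewrite addn1 big_nat_recr//= m1 addr0.
rewrite (@big_cat_nat _ _ _ (2 ^ n).-1)//= ?leq_addr//.
rewrite big_nat_cond big1 ?add0r; last by move=> i /andP[/andP[_ /m0 ->]].
rewrite -{1}[(2 ^ n).-1]add0n big_addn big_mkord addKn; apply: eq_bigr => i _.
congr (nat_of_bool _)%:R; rewrite /member -/n.
have -> : (2 ^ n <= (i + (2 ^ n).-1).+1 < 2 ^ n.+1)%N.
  by have := ltn_ord i; rewrite expnS; lia.
by congr (A k _); lia.
Qed.

(** Markov's inequality: the indicator is at most 2^k / n times the count, whose expectation is
    additive despite the dependence between the [B i]. *)
Lemma markov_count n (B : nat -> seq bool -> bool) k (p : R) :
  (0 < n)%N ->
  (forall i, (i < n)%N -> Ex n (fun s => (B i s)%:R) <= p) ->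
  Ex n (fun s => (n <= 2 ^ k * \sum_(i < n) B i s)%N%:R) <= 2 ^+ k * p.
Proof.
move=> n0 Bp.
have -> : 2 ^+ k * p = Ex n (fun=> 2 ^+ k * p) by rewrite Ex_cst.
apply: (@le_trans _ _ (Ex n (fun s => 2 ^+ k / n%:R * \sum_(i < n) (B i s)%:R))).
  apply: Ex_le => s _; case: leqP => [h|_] /=; last first.
    by rewrite mulr_ge0// ?divr_ge0 ?exprn_ge0// sumr_ge0.
  rewrite mulrAC ler_pdivlMr ?ltr0n// mul1r -natr_sum -natrX -natrM ler_nat.
  exact: h.
have SE := Ex_sum n n (fun i s => (B i s)%:R).
rewrite Ex_cst ExZ SE -mulrA ler_pM2l ?exprn_gt0//.
rewrite ler_pdivrMl ?ltr0n//.
apply: (@le_trans _ _ (\sum_(i < n) p)); first by apply: ler_sum => i _; exact: Bp.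
by rewrite sumr_const card_ord mulr_natl.
Qed.

Definition step (b : bool) : R := if b then 1 else -1.

Definition walk (s : seq bool) : R := \sum_(b <- s) step b.

Lemma walk_cons b s : walk (b :: s) = step b + walk s.
Proof. exact: big_cons. Qed.

Lemma walk_nil : walk [::] = 0. Proof. exact: big_nil. Qed.

Lemma walk_cat s t : walk (s ++ t) = walk s + walk t.
Proof. exact: big_cat. Qed.

Lemma walk_rev s : walk (rev s) = walk s.
Proof. by rewrite /walk (perm_big s) //= perm_rev. Qed.

Lemma walk_neg s : walk (map negb s) = - walk s.
Proof. by rewrite /walk big_map -sumrN; apply: eq_bigr => -[] _ //=; rewrite /step opprK. Qed.

(* Ville's inequality, for a supermartingale that is a function of the time and
   of the position of the walk. *)
Lemma ville (Z : nat -> R -> R) (c : R) n m x : 0 < c ->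
  (forall m x, 0 <= Z m x) ->
  (forall m x, Z m.+1 (x + 1) + Z m.+1 (x - 1) <= 2 * Z m x) ->
  Ex n (fun s => [exists l : 'I_n.+1, c <= Z (m + l)%N (x + walk (take l s))]%:R)
    <= Z m x / c.
Proof.
move=> c0 Z0 Zs; elim: n m x => [|n IH] m x.
  rewrite /=; case: existsP => [[l]|_]; last by rewrite divr_ge0// ltW.
  by rewrite ord1 /= walk_nil addn0 addr0 ler_pdivlMr// mul1r.
(* Stopping at once if the level is already reached: then the bound is at least 1. Otherwise time 0
   cannot be the witness, and conditioning on the first step applies. *)
have [cZ|Zc] := leP c (Z m x).
  apply: (@le_trans _ _ 1); last by rewrite ler_pdivlMr// mul1r.
  by rewrite -[leRHS](Ex_cst n.+1); apply: Ex_le => s _; case: [exists _, _].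
apply: (@le_trans _ _ ((Z m.+1 (x + 1) / c + Z m.+1 (x - 1) / c) / 2)); last first.
  by rewrite -mulrDl ler_pdivrMr// -mulrAC ler_pM2r ?invr_gt0// mulrC.
rewrite /= ler_pM2r ?invr_gt0//.
apply: lerD; (apply: le_trans (IH _ _); apply: Ex_le => s _; rewrite ler_nat).
all: case: existsP => // -[l]; rewrite -ltnS /=.
all: case: (unliftP ord0 l) => [j ->|->]; last by rewrite addn0 take0 walk_nil addr0 leNgt Zc.
all: rewrite lift0 /= walk_cons addrA addnS -addSn => cZ.
all: by rewrite ltnS lt0b; apply/existsP; exists j.
Qed.

End CoinTossing.

(** * Exponential estimates for the simple random walk *)

Section Cosh.
Variable R : realType.
Implicit Types x y : R.

Definition cosh x : R := (expR x + expR (- x)) / 2.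

Let coshsum x n : R := series (exp_coeff x) n + series (exp_coeff (- x)) n.

Let cvg_coshsum x : coshsum x @ \oo --> expR x + expR (- x).
Proof. by apply: cvgD; exact: is_cvg_series_exp_coeff. Qed.

Let coshsumS x n :
  coshsum x n.+1 = coshsum x n + (if odd n then 0 else 2 * (x ^+ n / n`!%:R)).
Proof.
rewrite /coshsum /series /= !big_nat_recr//= /exp_coeff /=.
by rewrite exprNn -signr_odd; case: (odd n) => /=; rewrite ?expr0 ?expr1; ring.
Qed.

Let term_ge0 x n : 0 <= (if odd n then 0 else 2 * (x ^+ n / n`!%:R) : R).
Proof.
case: ifP => // /negbT on; rewrite mulr_ge0// divr_ge0//.
by rewrite -(odd_double_half n) (negbTE on) add0n -mul2n exprM exprn_ge0// sqr_ge0.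
Qed.

Let coshsum_le x m n : (m <= n)%N -> coshsum x m <= coshsum x n.
Proof.
move=> /subnKC <-; elim: (n - m)%N => [|k IH]; first by rewrite addn0.
by rewrite addnS coshsumS (le_trans IH)// lerDl.
Qed.

Let fact_double n : (2 ^ n * n`! <= n.*2`!)%N.
Proof.
elim: n => // n IH; rewrite doubleS !factS expnS.
have := leq_mul (leqnn (n.*2.+2)) IH; move: (n.*2`!) (2 ^ n)%N (n`!) => a b c; nia.
Qed.

(** Termwise comparison of power series: x^(2n) / (2n)! is at most (x^2 / 2)^n / n!, because (2n)!
    is at least 2^n n!. *)
Lemma cosh_le x : cosh x <= expR (x ^+ 2 / 2).
Proof.
rewrite /cosh ler_pdivrMr//.
have H n : coshsum x n.*2 <= 2 * series (exp_coeff (x ^+ 2 / 2)) n.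
  elim: n => [|n IH]; first by rewrite /coshsum /series /= !big_geq// addr0 mulr0.
  rewrite doubleS !coshsumS /= odd_double /= addr0.
  rewrite /series /= big_nat_recr//= mulrDr lerD// ler_pM2l// /exp_coeff /=.
  rewrite -mul2n exprM expr_div_n -[leRHS]mulrA ler_wpM2l//.
    by apply: exprn_ge0; exact: sqr_ge0.
  rewrite -invfM -natrX -natrM lef_pV2 ?posrE ?ltr0n ?muln_gt0 ?expn_gt0 ?fact_gt0//.
  by rewrite ler_nat mul2n fact_double.
have <- : lim (coshsum x @ \oo) = expR x + expR (- x) by exact: cvg_lim.
apply: limr_le; first exact: cvgP (cvg_coshsum x).
apply: nearW => n; apply: le_trans (coshsum_le x n n.*2 _) _; first by rewrite -addnn leq_addr.
apply: le_trans (H n) _; rewrite mulrC ler_pM2r//.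
apply: nondecreasing_cvgn_le; last exact: is_cvg_series_exp_coeff.
apply/nondecreasing_seqP => i; rewrite /series /= big_nat_recr//= lerDl exp_coeff_ge0//.
by rewrite divr_ge0// sqr_ge0.
Qed.

Lemma cosh_ge x : 1 + x ^+ 2 / 2 <= cosh x.
Proof.
rewrite /cosh ler_pdivlMr//.
have <- : coshsum x 3 = (1 + x ^+ 2 / 2) * 2.
  rewrite !coshsumS /= /coshsum /series /= !big_geq// !factS fact0 expr0.
  by field.
have <- : lim (coshsum x @ \oo) = expR x + expR (- x) by exact: cvg_lim.
apply: limr_ge; first exact: cvgP (cvg_coshsum x).
by near=> n; apply: coshsum_le; near: n; exact: nbhs_infty_ge.
Unshelve. all: by end_near. Qed.

(** With u = x^2 / 2, the chain is u - u^2 <= u / (1 + u) and exp (u / (1 + u)) <= 1 + u <= cosh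
    x. *)
Lemma cosh_ge_expR x : expR (x ^+ 2 / 2 - x ^+ 4 / 4) <= cosh x.
Proof.
apply: le_trans (cosh_ge x); set u := x ^+ 2 / 2.
have u0 : 0 <= u by rewrite divr_ge0// sqr_ge0.
have -> : x ^+ 4 / 4 = u ^+ 2 by rewrite /u; field.
apply: (@le_trans _ _ (expR (u / (1 + u)))).
  rewrite ler_expR ler_pdivlMr ?ltr_wpDr//.
  have : 0 <= u ^+ 3 by rewrite exprn_ge0.
  by rewrite !exprS expr0; lra.
have u1 : 0 < 1 + u by rewrite ltr_wpDr.
rewrite -[expR _]invrK -expRN invf_ple ?posrE ?expR_gt0//.
apply: le_trans (expR_ge1Dx _).
by rewrite le_eqVlt; apply/orP; left; apply/eqP; field; rewrite gt_eqF.
Qed.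

End Cosh.

Section Tails.
Variable R : realType.
Implicit Types (x y l : R) (n m : nat).

Lemma mgf_walk n (t : R) : Ex R n (fun s => expR (t * walk R s)) = cosh R t ^+ n.
Proof.
elim: n => [|n IH]; first by rewrite /= walk_nil mulr0 expR0 expr0.
rewrite /=.
have E b : Ex R n (fun s => expR (t * walk R (b :: s))) = expR (t * step R b) * cosh R t ^+ n.
  by rewrite -IH -ExZ; apply: Ex_ext => s _; rewrite walk_cons mulrDr expRD.
by rewrite !E /step mulr1 mulrN1 -mulrDl mulrAC exprS.
Qed.

Lemma cosh_expn_le n (t : R) : cosh R t ^+ n <= expR (n%:R * t ^+ 2 / 2).
Proof.
have c0 : 0 <= cosh R t by rewrite divr_ge0// addr_ge0// expR_ge0.
by rewrite -mulrA mulrC expRM_natr lerXn2r ?nnegrE ?expR_ge0 ?cosh_le.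
Qed.

(* Under the exponential tilt by [l / sqrt m], the walk concentrates around
   [l * sqrt m]; exponential moments bound both tails of the tilted measure. *)
Lemma walk_lower_tail m l : (0 < m)%N -> 0 <= l -> l ^+ 4 <= m%:R ->
  expR (- (l ^+ 2 / 2) - 2 * l) / 4 <=
  Ex R m (fun s => ((l - 2) * Num.sqrt m%:R <= walk R s)%R%:R).
Proof.
move=> m0 l0 lm; set P := Ex _ _ _; set sg := Num.sqrt m%:R : R.
have sg2 : m%:R = sg ^+ 2 by rewrite sqr_sqrtr.
have sg0 : 0 < sg by rewrite sqrtr_gt0 ltr0n.
have sgn0 : sg != 0 by rewrite gt_eqF.
have H1 : expR (l ^+ 2 / 2 - l ^+ 4 / m%:R / 4) <= cosh R (l / sg) ^+ m.
  rewrite -[leLHS](_ : expR ((l / sg) ^+ 2 / 2 - (l / sg) ^+ 4 / 4) ^+ m = _).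
    apply: lerXn2r; last exact: cosh_ge_expR; rewrite nnegrE ?expR_ge0//.
    by rewrite divr_ge0// addr_ge0// expR_ge0.
  by rewrite -expRM_natr; congr expR; rewrite sg2; field.
(* Pointwise bound by three ranges of the walk. Below [(l - 2) * sg] and above [(l + 2) * sg],
   changing the tilt by 2 / sg dominates; in between, the exponent is at most l^2 + 2l. *)
have H2 : cosh R (l / sg) ^+ m <= expR (l ^+ 2 + 2 * l) * P +
    expR (2 * (l - 2)) * cosh R ((l - 2) / sg) ^+ m +
    expR (- (2 * (l + 2))) * cosh R ((l + 2) / sg) ^+ m.
  rewrite -!mgf_walk -!ExZ -!ExD; apply: Ex_le => s _; set S := walk R s.
  rewrite -!expRD; have e0 x : 0 <= expR x by exact: expR_ge0.
  have [xS|Sx] := leP ((l - 2) * sg) S; last first.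
    rewrite mulr0 add0r -[leLHS]addr0 lerD// ler_expR.
    have -> : 2 * (l - 2) + (l - 2) / sg * S =
      l / sg * S + 2 / sg * ((l - 2) * sg - S) by field.
    by rewrite lerDl mulr_ge0// ?divr_ge0 ?ltW// subr_gt0.
  rewrite mulr1; have [yS|Sy] := leP ((l + 2) * sg) S.
    rewrite -[leLHS]add0r lerD ?addr_ge0// ler_expR.
    have -> : - (2 * (l + 2)) + (l + 2) / sg * S =
      l / sg * S + 2 / sg * (S - (l + 2) * sg) by field.
    by rewrite lerDl mulr_ge0// ?divr_ge0 ?subr_ge0// ltW.
  rewrite -addrA -[leLHS]addr0 lerD ?addr_ge0// ler_expR.
  have -> : l ^+ 2 + 2 * l = l / sg * ((l + 2) * sg) by field.
  by rewrite ler_wpM2l ?divr_ge0// ltW.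
have H3 : expR (2 * (l - 2)) * cosh R ((l - 2) / sg) ^+ m <= expR (l ^+ 2 / 2) * expR (- 2).
  apply: (le_trans (ler_wpM2l (expR_ge0 _) (cosh_expn_le _ _))).
  rewrite -!expRD ler_expR sg2 le_eqVlt; apply/orP; left; apply/eqP.
  by field.
have H4 : expR (- (2 * (l + 2))) * cosh R ((l + 2) / sg) ^+ m <= expR (l ^+ 2 / 2) * expR (- 2).
  apply: (le_trans (ler_wpM2l (expR_ge0 _) (cosh_expn_le _ _))).
  rewrite -!expRD ler_expR sg2 le_eqVlt; apply/orP; left; apply/eqP.
  by field.
(* Mass balance in units of exp (l^2 / 2): the total is at least 3/4 since l^4 <= m, each tail takes
   at most exp (-2) <= 1/4, so 1/4 remains for the middle. *)
have H5 : 3 / 4 <= expR (- (l ^+ 4 / m%:R / 4)).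
  apply: le_trans (expR_ge1Dx _).
  have : l ^+ 4 / m%:R <= 1 by rewrite ler_pdivrMr ?ltr0n// mul1r.
  by lra.
have H6 : expR (- 2) <= 1 / 4 :> R.
  have -> : expR (- 2 : R) = (expR 1 ^+ 2)^-1 by rewrite -expRM_natr -expRN mul1r.
  have e2 : 2 <= expR 1 :> R by apply: le_trans (expR_ge1Dx _).
  rewrite mul1r lef_pV2 ?posrE ?exprn_gt0// ?(lt_le_trans _ e2)//.
  by rewrite (_ : 4 = 2 ^+ 2 :> R) ?lerXn2r ?nnegrE ?expR_ge0//; ring.
have e0 : 0 < expR (l ^+ 2 / 2) by exact: expR_gt0.
rewrite expRD in H1.
have H7 : expR (l ^+ 2 / 2) / 4 <= expR (l ^+ 2 + 2 * l) * P.
  have := ler_wpM2l (ltW e0) H5; have := ler_wpM2l (ltW e0) H6.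
  move: H1 H2 H3 H4; lra.
have -> : - (l ^+ 2 / 2) - 2 * l = l ^+ 2 / 2 - (l ^+ 2 + 2 * l) by field.
by rewrite expRD expRN mulrAC ler_pdivrMr ?expR_gt0// [leRHS]mulrC.
Qed.

(* One exponential supermartingale for each of the times [(nu * mu ^+ j) ^+ 2];
   tuned to one of them, it loses only [(mu - 1) ^+ 2] up to the next one. *)
Lemma walk_maximal n J (l mu nu : R) : 0 <= l -> 1 < mu -> 0 < nu ->
  Ex R n (fun s => [exists i : 'I_n.+1, [&& nu ^+ 2 <= i%:R,
     i%:R < (nu * mu ^+ J) ^+ 2 &
     l ^+ 2 * i%:R <= walk R (take i s) ^+ 2]]%:R) <=
  2 * J%:R * expR (- (l ^+ 2 / 2 * (1 - (mu - 1) ^+ 2))).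
Proof.
move=> l0 mu1 nu0; set c := l ^+ 2 / 2 * _.
have mu0 : 0 < mu by rewrite (lt_trans _ mu1).
pose lam j := l / (nu * mu ^+ j).
(* The two signs of the exponent control the absolute value of the walk; they make the initial value
   2, whence the factor 2 J. *)
pose T (j m : nat) x := (expR (lam j * x) + expR (- (lam j * x))) * expR (- (lam j ^+ 2 * m%:R / 2)).
pose Z m x := \sum_(j < J) T j m x.
have T0 j m x : 0 <= T j m x by rewrite mulr_ge0 ?addr_ge0 ?expR_ge0.
have Z0 m x : 0 <= Z m x by apply: sumr_ge0.
have ZS m x : Z m.+1 (x + 1) + Z m.+1 (x - 1) <= 2 * Z m x.
  rewrite /Z -big_split mulr_sumr; apply: ler_sum => j _; rewrite /T /=.
  have -> : - (lam j ^+ 2 * m.+1%:R / 2) = - (lam j ^+ 2 * m%:R / 2) - lam j ^+ 2 / 2.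
    by rewrite -natr1; field.
  rewrite !mulrDr mulrN1 !opprD opprK mulr1 !expRD.
  set a := lam j; set p := expR (a * x); set q := expR (- (a * x)); set b := expR (- (_ * _ / _)).
  have := cosh_le R a; rewrite /cosh ler_pdivrMr// => ch.
  have p0 : 0 < p by exact: expR_gt0.
  have q0 : 0 < q by exact: expR_gt0.
  have b0 : 0 < b by exact: expR_gt0.
  rewrite [expR (- (a ^+ 2 / 2))]expRN; have d0 := expR_gt0 (a ^+ 2 / 2); move: ch d0.
  set d := expR (a ^+ 2 / 2) => ch d0.
  have -> : (p * expR a + q * expR (- a)) * (b / d) + (p * expR (- a) + q * expR a) * (b / d) =
    (p + q) * b * ((expR a + expR (- a)) / d) by ring.
  rewrite mulrC; apply: ler_wpM2r; first by rewrite mulr_ge0 ?addr_ge0 ?ltW.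
  by rewrite ler_pdivrMr// mulrC.
have := @ville R Z (expR c) n 0%N 0 (expR_gt0 _) Z0 ZS.
have -> : Z 0%N 0 / expR c = 2 * J%:R * expR (- c).
  rewrite expRN; congr (_ / _); rewrite /Z (eq_bigr (fun=> 2)).
    by rewrite sumr_const card_ord mulr_natr.
  by move=> j _; rewrite /T !mulr0 mul0r oppr0 expR0 mulr1.
apply: le_trans; apply: Ex_le => s _; rewrite ler_nat; case: existsP => // -[i /and3P[i1 i2 i3]].
rewrite lt0b; apply/existsP; exists i; rewrite add0n add0r; set x := walk R _ in i3 *.
have [j jJ /andP[j1 j2]] : exists2 j, (j < J)%N & nu * mu ^+ j <= Num.sqrt i%:R <= nu * mu ^+ j.+1.
  elim: J i2 {T Z T0 Z0 ZS} => [|J' IH] i2.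
    by move: i2; rewrite expr0 mulr1 ltNge i1.
  have [h|h] := ltP (i%:R) ((nu * mu ^+ J') ^+ 2).
    by have [j jJ] := IH h; exists j => //; exact: ltnW.
  exists J' => //; apply/andP; split.
    by rewrite -(@ler_pXn2r _ 2) ?nnegrE ?sqrtr_ge0 ?sqr_sqrtr// mulr_ge0 ?exprn_ge0 ?ltW.
  rewrite -(@ler_pXn2r _ 2) ?nnegrE ?sqrtr_ge0 ?sqr_sqrtr//; first exact: ltW.
  by rewrite mulr_ge0 ?exprn_ge0 ?ltW.
have r0 : 0 < nu * mu ^+ j by rewrite mulr_gt0 ?exprn_gt0.
apply: (@le_trans _ _ (T j i x)); last first.
  by rewrite /Z (bigD1 (Ordinal jJ))//= lerDl sumr_ge0.
(* How far the time is from the one to which component [j] is tuned. The exponent reached is l^2 (v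
   - v^2 / 2) = l^2 / 2 (1 - (v - 1)^2), with v between 1 and mu. *)
pose v := Num.sqrt i%:R / (nu * mu ^+ j).
have v1 : 1 <= v by rewrite ler_pdivlMr// mul1r.
have v2 : v <= mu by rewrite ler_pdivrMr// mulrCA -exprS.
have lx : l * Num.sqrt i%:R <= `|x|.
  rewrite -(@ler_pXn2r _ 2) ?nnegrE ?mulr_ge0 ?sqrtr_ge0//.
  by rewrite exprMn sqr_sqrtr// real_normK// num_real.
apply: (@le_trans _ _ (expR (lam j * `|x|) * expR (- (lam j ^+ 2 * i%:R / 2)))); last first.
  rewrite /T ler_pM2r ?expR_gt0//; have [x0|x0] := ger0P x.
    by rewrite lerDl expR_ge0.
  by rewrite mulrN lerDr expR_ge0.
rewrite -expRD ler_expR.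
apply: (@le_trans _ _ (l ^+ 2 * v - l ^+ 2 * v ^+ 2 / 2)).
  rewrite /c; have : 0 <= l ^+ 2 by exact: sqr_ge0.
  have : (v - 1) ^+ 2 <= (mu - 1) ^+ 2 by rewrite lerXn2r ?nnegrE; lra.
  by rewrite !expr2; nra.
apply: lerD.
  have -> : l ^+ 2 * v = lam j * (l * Num.sqrt i%:R) by rewrite /lam /v; ring.
  by rewrite ler_wpM2l// divr_ge0// ltW.
rewrite lerN2 /v /lam [in leRHS]expr_div_n sqr_sqrtr// expr_div_n.
by rewrite le_eqVlt; apply/orP; left; apply/eqP; ring.
Qed.

End Tails.

(** * Decidable tests *)

(* By symmetry, whatever the past, with probability at least [p] the next
   increment is at least [x j] in the direction away from 0. *)
Lemma walk_small_blocks (R : realType) (m : nat -> nat) (x : nat -> R) (p : R) n :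
  {homo m : i j / (i <= j)%N} -> p <= 1 ->
  (forall j, (j < n)%N -> p <= Ex R (m j.+1 - m j) (fun s => (x j <= walk R s)%R%:R)) ->
  Ex R (m n) (fun s => [forall j : 'I_n, `|walk R (take (m j.+1) s)| < x j]%:R) <= (1 - p) ^+ n.
Proof.
move=> mm p1; elim: n => [|n IH] pE.
  by rewrite expr0 -[leRHS](Ex_cst R (m 0%N)); apply: Ex_le => s _; case: [forall _, _].
have mn : (m n <= m n.+1)%N by exact: mm.
have sym z : Ex R (m n.+1 - m n) (fun s => (`|z + walk R s| < x n)%R%:R) <= 1 - p.
  have P1 : Ex R (m n.+1 - m n) (fun s => 1 - (x n <= walk R s)%R%:R) <= 1 - p.
    under Ex_ext => s _ do rewrite -mulN1r.
    by rewrite ExD Ex_cst ExZ mulN1r lerD2l lerN2 pE.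
  have [z0|z0] := leP 0 z.
    apply: le_trans P1; apply: Ex_le => s _.
    have [h|h] := leP (x n) (walk R s); last by rewrite subr0 lern1 leq_b1.
    rewrite subrr ltNge (le_trans h)//.
    by rewrite (le_trans _ (ler_norm _))// lerDr.
  apply: le_trans P1; rewrite -[leRHS]Ex_neg; apply: Ex_le => s _; rewrite walk_neg.
  have [h|h] := leP (x n) (- walk R s); last by rewrite subr0 lern1 leq_b1.
  rewrite subrr ltNge (le_trans h)//.
  by rewrite -normrN (le_trans _ (ler_norm _))// opprD lerDr oppr_ge0 ltW.
rewrite -{1}(subnKC mn) Ex_cat.
apply: (@le_trans _ _ (Ex R (m n) (fun u => (1 - p) *
    [forall j : 'I_n, `|walk R (take (m j.+1) u)| < x j]%:R))); last first.
  rewrite ExZ exprS ler_wpM2l ?subr_ge0// IH// => j jn.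
  by apply: pE; exact: ltnW.
apply: Ex_le => u um; rewrite mulrC.
apply: (@le_trans _ _ (Ex R (m n.+1 - m n) (fun v => [forall j : 'I_n, `|walk R (take (m j.+1) u)| < x j]%:R *
   (`|walk R u + walk R v| < x n)%R%:R))); last by rewrite ExZ ler_wpM2l.
apply: Ex_le => v vm; rewrite -natrM mulnb ler_nat.
case: forallP => // H; rewrite lt0b; apply/andP; split.
  apply/forallP => j; have := H (widen_ord (leqnSn n) j) => /=.
  by rewrite takel_cat// um; exact: mm.
have := H ord_max => /=; rewrite take_oversize ?walk_cat//.
by rewrite size_cat um vm subnKC.
Qed.

(** * Positions of the walk computed from string codes *)

Section Displacement.
Local Open Scope nat_scope.

Lemma nat_of_bits_nth s l : l < size s ->
  ((nat_of_bits s).+1 %/ 2 ^ l) %% 2 = nth false s l.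
Proof.
elim: s l => // b s IH [|l] ls; rewrite nat_of_bits_cons.
  by rewrite expn0 divn1 /=; case: b {ls}; lia.
rewrite expnS divnMA /= -IH//; congr ((_ %/ _) %% _).
by case: b {ls}; lia.
Qed.

(* For [y = nat_of_bits s], the number of [true]s among the first [i] bits. *)
Definition ones y i := \sum_(l < i) (y.+1 %/ 2 ^ l) %% 2.

(** The walk after [i] steps is 2 [ones y i] - i; two truncated subtractions, one of which vanishes,
    give the absolute difference within [nat]. *)
Definition displacement y i j :=
  (2 * ones y j + i - (2 * ones y i + j)) + (2 * ones y i + j - (2 * ones y j + i)).

Lemma walk_ones (R : realType) s i : i <= size s ->
  walk R (take i s) = (2 * (ones (nat_of_bits s) i)%:R - i%:R)%R.
Proof.
move=> iss; rewrite /ones; elim: i iss => [|i IH] iss.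
  by rewrite take0 walk_nil big_ord0 mulr0 subr0.
rewrite (take_nth false iss) -cats1 walk_cat (IH (ltnW iss)) walk_cons walk_nil addr0.
rewrite big_ord_recr /=.
rewrite (nat_of_bits_nth _ _ iss).
rewrite natrD -natr1.
by rewrite /step; case: nth => /=; ring.
Qed.

Lemma displacementE (R : realType) s i j : i <= size s -> j <= size s ->
  ((displacement (nat_of_bits s) i j)%:R = `|walk R (take j s) - walk R (take i s)|)%R.
Proof.
move=> iss jss; rewrite !walk_ones// /displacement.
set u := ones _ j; set v := ones _ i.
have -> : (2 * u%:R - j%:R - (2 * v%:R - i%:R) = (2 * u + i)%N%:R - (2 * v + j)%N%:R :> R)%R.
  by rewrite !natrD addr0; ring.
have [h|/ltnW h] := leqP (2 * u + i) (2 * v + j).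
  by rewrite (eqP h) add0n natrB// distrC ger0_norm// subr_ge0 ler_nat.
by rewrite (eqP h) addn0 natrB// ger0_norm// subr_ge0 ler_nat.
Qed.

Lemma recursive_displacement k F G H : recursive k F -> recursive k G -> recursive k H ->
  recursive k (fun e => displacement (F e) (G e) (H e)).
Proof.
have ro F' G' : recursive k F' -> recursive k G' -> recursive k (fun e => ones (F' e) (G' e)).
  move=> rF rG; apply: (@recursive_sum _ _ (fun l e => ((F' e).+1 %/ 2 ^ l) %% 2)) => //.
  apply: recursive_mod; last exact: recursive_const.
  apply: recursive_div; first exact/recursiveS/recursive_shift.
  by apply: recursiveX; [exact: recursive_const|exact: recursive_var].
move=> rF rG rH; have r2 F' : recursive k F' -> recursive k (fun e => 2 * F' e).
  by apply: recursiveM; exact: recursive_const.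
by apply: recursiveD; apply: recursiveB; apply: recursiveD => //; apply/r2/ro.
Qed.

End Displacement.

Section Tests.
Local Open Scope nat_scope.
Variables (psi : nat -> nat) (C g a : nat).
Hypothesis cpsi : computable_fun psi.

(* The [k]-th pair of tests concerns the increments [h] with
   [2 ^ - scale k.+1 <= |h| <= 2 ^ - scale k]: there [log (log (1 / |h|))] is
   [C * k * log 2], up to a factor tending to 1. *)
Definition scale k := 2 ^ (C * k).

(** The summand [g * scale k.+1] makes the error 2^-precision at most every increment tested in the
    window; [k] adds room for factors polynomial in [k]. *)
Definition precision k := g * scale k.+1 + k.

(** The factor 4^precision makes the spatial step 1 / sqrt N at most 2^-precision and lets dyadic
    blocks divide N exactly; the other factor puts N beyond the modulus at that precision. *)
Definition resolution k := 4 ^ precision k * (psi (precision k)).+1.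

(** The window is widened by a factor 2 at both ends, so that rounding an increment to the grid
    keeps it inside. *)
Definition too_large k y i := [exists j : 'I_(resolution k).+1,
  [&& resolution k <= 2 * ((i - j) + (j - i)) * 2 ^ scale k.+1,
      ((i - j) + (j - i)) * 2 ^ scale k <= 2 * resolution k &
      a * k * ((i - j) + (j - i)) <= displacement y i j ^ 2]].

Definition block k r := resolution k %/ 2 ^ (g * (scale k + r)).

(** Requiring the blocks to stay in the grid declares times too close to 1 good; for a fixed t < 1
    this excuse disappears as [k] grows. *)
Definition too_small k y i := [forall r : 'I_(scale k.+1 - scale k),
  (i + block k r <= resolution k) &&
  (displacement y i (i + block k r) ^ 2 < a * k * block k r)].

Let recursive_scale k F : recursive k F -> recursive k (fun e => scale (F e)).
Proof.
by move=> rF; apply: recursiveX; [|apply: recursiveM => //]; exact: recursive_const.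
Qed.

Let recursive_resolution k F : recursive k F -> recursive k (fun e => resolution (F e)).
Proof.
move=> rF; have rp : recursive k (fun e => precision (F e)).
  apply: recursiveD => //; apply: recursiveM; first exact: recursive_const.
  exact/recursive_scale/recursiveS.
apply: recursiveM; last exact/recursiveS/recursive_fun.
by apply: recursiveX => //; exact: recursive_const.
Qed.

Lemma computable_resolution : computable_fun resolution.
Proof.
have := @recursive_resolution 1 _ (@recursive_var 1 0 isT).
by apply: partial_recursive_ext => v y; case/tupleP: v => b v.
Qed.

Lemma resolution_gt0 k : 0 < resolution k.
Proof. by rewrite muln_gt0 expn_gt0. Qed.

Let r2X k F : recursive k F -> recursive k (fun e => 2 ^ F e).
Proof. by apply: recursiveX; exact: recursive_const. Qed.

Lemma recursive_too_large :
  recursive 3 (fun e => nat_of_bool (too_large (e 0) (e 1) (e 2))).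
Proof.
have v i : i < 4 -> recursive 4 (fun e => e i) by exact: recursive_var.
have rN : recursive 4 (fun e => resolution (e 1)) by exact/recursive_resolution/v.
have rd : recursive 4 (fun e => (e 3 - e 0) + (e 0 - e 3)).
  by apply: recursiveD; apply: recursiveB; exact: v.
have c n : recursive 4 (fun=> n) by exact: recursive_const.
apply: (@recursive_exists _ _ (fun j e =>
  [&& resolution (e 0) <= 2 * ((e 2 - j) + (j - e 2)) * 2 ^ scale (e 0).+1,
      ((e 2 - j) + (j - e 2)) * 2 ^ scale (e 0) <= 2 * resolution (e 0) &
      a * e 0 * ((e 2 - j) + (j - e 2)) <= displacement (e 1) (e 2) j ^ 2])).
  exact/recursiveS/recursive_resolution/recursive_var.
apply: recursive_and.
  apply: recursive_leq => //; apply: recursiveM; first exact: recursiveM.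
  exact/r2X/recursive_scale/recursiveS/v.
apply: recursive_and.
  apply: recursive_leq; last exact: recursiveM.
  by apply: recursiveM => //; exact/r2X/recursive_scale/v.
apply: recursive_leq; first by apply: recursiveM => //; apply: recursiveM => //; exact: v.
by apply: recursiveX => //; apply: recursive_displacement; exact: v.
Qed.

Lemma recursive_too_small :
  recursive 3 (fun e => nat_of_bool (too_small (e 0) (e 1) (e 2))).
Proof.
have v i : i < 4 -> recursive 4 (fun e => e i) by exact: recursive_var.
have c n : recursive 4 (fun=> n) by exact: recursive_const.
have rN : recursive 4 (fun e => resolution (e 1)) by exact/recursive_resolution/v.
have rb : recursive 4 (fun e => block (e 1) (e 0)).
  apply: recursive_div => //; apply/r2X/recursiveM => //.
  by apply: recursiveD; [exact/recursive_scale/v|exact: v].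
apply: (@recursive_forall _ _ (fun r e =>
  (e 2 + block (e 0) r <= resolution (e 0)) &&
  (displacement (e 1) (e 2) (e 2 + block (e 0) r) ^ 2 < a * e 0 * block (e 0) r))).
  by apply: recursiveB; apply: recursive_scale; try apply: recursiveS; exact: recursive_var.
have rib : recursive 4 (fun e => e 3 + block (e 1) (e 0)) by apply: recursiveD => //; exact: v.
apply: recursive_and; first exact: recursive_leq.
apply: recursive_leq.
  by apply/recursiveS/recursiveX => //; apply: recursive_displacement => //; exact: v.
by apply: recursiveM => //; apply: recursiveM => //; exact: v.
Qed.

End Tests.

Lemma few_failures (R : realType) (U : machine) (N : nat -> nat)
    (B : nat -> nat -> nat -> bool) (s_ : nat -> seq bool) (d k0 : nat) :
  universal_prefix_machine R U ->
  computable_fun N -> (forall k, 0 < N k)%N ->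
  recursive 3 (fun e => nat_of_bool (B (e 0%N) (e 1%N) (e 2))) ->
  (forall n, size (s_ n) = n) ->
  (forall n, (0 < n)%N -> ((n%:R - d%:R)%:E <= complexity R U (s_ n))%E) ->
  (forall k i, (k0 <= k)%N -> (i < N k)%N ->
     Ex R (N k) (fun s => (B k (nat_of_bits s) i)%:R) <= 2^-1 ^+ (3 * k + 1)) ->
  exists K, forall k, (K <= k)%N ->
    (2 ^ k * \sum_(i < N k) B k (nat_of_bits (s_ (N k))) i < N k)%N.
Proof.
move=> hU cN N0 rB ss cs Bp.
pose A k y := (N k <= 2 ^ k * \sum_(i < N k) B k y i)%N.
have rA : recursive 2 (fun e => nat_of_bool (A (e 0%N) (e 1%N))).
  have rN : recursive 2 (fun e => N (e 0%N)) by apply: recursive_fun => //; exact: recursive_var.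
  apply: recursive_leq => //; apply: recursiveM.
    by apply: recursiveX; [exact: recursive_const|exact: recursive_var].
  apply: (@recursive_sum _ _ (fun i e => nat_of_bool (B (e 0%N) (e 1%N) i))) => //.
  apply: (@recursive_comp 3 (fun e => nat_of_bool (B (e 0%N) (e 1%N) (e 2)))
    [:: (fun e => e 1%N); (fun e => e 2); (fun e => e 0%N)]) => //.
  by move=> [|[|[|]]]// _; exact: recursive_var.
have [K HK] := @effective_borel_cantelli R U N A s_ d hU cN N0 rA ss cs.
exists (maxn K k0) => k; rewrite geq_max => /andP[Kk k0k].
have := HK k Kk; rewrite /A -ltnNge; apply.
rewrite -(ler_nat R) natrM sum_member.
have := @markov_count R (N k) (fun i s => B k (nat_of_bits s) i) k _ (N0 k) (fun i => Bp k i k0k).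
move=> h; rewrite -mulrA -[leRHS]mulr1 ler_pM2l ?ltr0n ?expn_gt0//.
rewrite natrX -ler_pdivlMr ?exprn_gt0//; apply: le_trans h _.
rewrite exprVn mul1r -[(3 * k + 1)%N](_ : k + (2 * k).+1 = _)%N; last lia.
by rewrite exprD invfM mulrA mulfV ?mul1r// expf_eq0 pnatr_eq0 andbF.
Qed.

(** * Probabilities of the tests *)

Section TestBounds.
Variable R : realType.
Variables (psi : nat -> nat) (C g a : nat).

Local Notation N := (resolution psi C g).
Local Notation w := (scale C).

Lemma eventually_le_nat (x : R) : exists k0, forall k, (k0 <= k)%N -> x <= k%:R.
Proof.
exists (Num.truncn x).+1 => k xk; apply: ltW; apply: lt_le_trans (truncnS_gt x) _.
by rewrite ler_nat.
Qed.

(** In [C + 4], the C pays for the roughly 2^(C k) components of the mixture, 3 is the target rate,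
    and the last 1 absorbs the constants once k >= 5 + q + C. *)
Lemma too_large_prob (mu : R) (q : nat) : (0 < q)%N -> 1 < mu -> 2 <= mu ^+ q ->
  (C + 4)%:R * ln 2 <= a%:R / 2 * (1 - (mu - 1) ^+ 2) ->
  exists k0, forall k i, (k0 <= k)%N -> (i < N k)%N ->
    Ex R (N k) (fun s => (too_large psi C g a k (nat_of_bits s) i)%:R) <= 2^-1 ^+ (3 * k + 1).
Proof.
move=> q0 mu1 muq aC.
exists (5 + q + C)%N => k i k0k iN.
set n := N k; set w' := w k.+1.
have n0 : (0 < n)%N by exact: resolution_gt0.
pose nu : R := Num.sqrt (n%:R / (2 * 2 ^+ w')).
have nu2 : nu ^+ 2 = n%:R / (2 * 2 ^+ w') by rewrite sqr_sqrtr// divr_ge0 ?mulr_ge0 ?exprn_ge0.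
have nu0 : 0 < nu by rewrite sqrtr_gt0 divr_gt0 ?ltr0n// mulr_gt0 ?exprn_gt0.
pose l : R := Num.sqrt (a * k)%:R.
have l2 : l ^+ 2 = (a * k)%:R by rewrite sqr_sqrtr.
(* From [nu ^ 2] to the largest time of the window the ratio is at most 4 * 2^w', and [q] factors
   [mu] at least double. *)
pose J := (q * (w' + 3))%N.
have muJ : 2 ^+ (w' + 3) <= mu ^+ J.
  by rewrite /J exprM lerXn2r ?nnegrE ?exprn_ge0//; lra.
pose F m t := [exists i : 'I_m.+1, [&& nu ^+ 2 <= i%:R,
     i%:R < (nu * mu ^+ J) ^+ 2 & l ^+ 2 * i%:R <= walk R (take i t) ^+ 2]].
have FE m : Ex R m (fun t => (F m t)%:R) <=
    2 * J%:R * expR (- (l ^+ 2 / 2 * (1 - (mu - 1) ^+ 2))).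
  by apply: walk_maximal => //; exact: sqrtr_ge0.
have range m : (n <= 2 * m * 2 ^ w')%N -> (m * 2 ^ w k <= 2 * n)%N ->
    nu ^+ 2 <= m%:R < (nu * mu ^+ J) ^+ 2.
  move=> h1 h2; apply/andP; split.
    rewrite nu2 ler_pdivrMr ?mulr_gt0 ?exprn_gt0// -natrX -natrM -natrM ler_nat.
    by apply: leq_trans h1 _; rewrite mulnA [(2 * m)%N]mulnC.
  rewrite exprMn nu2 mulrAC ltr_pdivlMr ?mulr_gt0 ?exprn_gt0//.
  have h3 : (m <= 2 * n)%N by apply: leq_trans h2; rewrite leq_pmulr// expn_gt0.
  have h4 : (m%:R : R) <= 2 * n%:R by rewrite -natrM ler_nat.
  have h5 : 2 ^+ (w' + 3) <= (mu ^+ J) ^+ 2.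
    apply: le_trans muJ _; rewrite expr2 ler_peMr ?exprn_ge0 ?exprn_ege1//; lra.
  have N0 : 0 < (n%:R : R) by rewrite ltr0n.
  apply: (@lt_le_trans _ _ (n%:R * 2 ^+ (w' + 3))); last by rewrite ler_pM2l.
  rewrite exprD; have e0 : 0 < 2 ^+ w' :> R by rewrite exprn_gt0.
  apply: (@le_lt_trans _ _ (2 * n%:R * (2 * 2 ^+ w'))).
    by rewrite ler_wpM2r// mulr_ge0// ltW.
  have : 0 < n%:R * 2 ^+ w' :> R by rewrite mulr_gt0.
  by rewrite (_ : 2 ^+ 3 = 8)//; [lra|rewrite -natrX].
apply: (@le_trans _ _ (2 * (2 * J%:R * expR (- (l ^+ 2 / 2 * (1 - (mu - 1) ^+ 2)))))).
  (* Increments to the right of [i] are those of the suffix; those to the left are read backwards,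
     on the reversed prefix, which has the same law. *)
  apply: (@le_trans _ _ (Ex R n (fun s => (F (n - i)%N (drop i s))%:R) +
                         Ex R n (fun s => (F i (rev (take i s)))%:R))); last first.
    rewrite (@Ex_drop _ n i (fun u => (F (n - i)%N u)%:R)) 1?ltnW// (@Ex_take _ n i (fun u => (F i (rev u))%:R)) 1?ltnW//.
    rewrite (Ex_rev _ i (fun u => (F i u)%:R)).
    by rewrite mulr_natl mulr2n lerD.
  rewrite -ExD; apply: Ex_le => s sn; rewrite -natrD ler_nat.
  case: (boolP (too_large _ _ _ _ _ _ _)) => // /existsP[[j jn]] /= /and3P[h1 h2 h3].
  have iss : (i <= size s)%N by rewrite sn ltnW.
  have jss : (j <= size s)%N by rewrite sn -ltnS.
  have [r1 r2] := andP (range _ h1 h2).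
  have h4 : l ^+ 2 * ((i - j) + (j - i))%N%:R <=
      (walk R (take j s) - walk R (take i s)) ^+ 2.
    rewrite l2 -natrM -real_normK ?num_real// -displacementE// -natrX ler_nat.
    exact: h3.
  have [ij|ji] := leqP i j.
    have ij0 : (i - j = 0)%N by apply/eqP.
    rewrite ij0 add0n in r1 r2 h4.
    have -> // : F (n - i)%N (drop i s).
    have jlt : (j - i < (n - i).+1)%N by rewrite ltnS leq_sub2r.
    apply/existsP; exists (Ordinal jlt) => /=; rewrite r1 r2 /=.
    apply: le_trans h4 _; rewrite -{1}(subnKC ij) takeD walk_cat.
    by rewrite addrAC subrr add0r.
  have ji0 : (j - i = 0)%N by apply/eqP; exact: ltnW.
  rewrite ji0 addn0 in r1 r2 h4.
  have -> : F i (rev (take i s)); last by rewrite addn1.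
  have jlt : (i - j < i.+1)%N by rewrite ltnS leq_subr.
  apply/existsP; exists (Ordinal jlt) => /=; rewrite r1 r2 /=.
  apply: le_trans h4 _; rewrite take_rev walk_rev size_takel// subKn 1?ltnW//.
  rewrite -{1}(cat_take_drop j (take i s)) walk_cat take_takel 1?ltnW//.
  by rewrite opprD addrA subrr add0r sqrrN.
have eb : expR (- (l ^+ 2 / 2 * (1 - (mu - 1) ^+ 2))) <= 2^-1 ^+ ((C + 4) * k).
  have -> : 2^-1 ^+ ((C + 4) * k) = expR (- ((C + 4)%:R * ln 2 * k%:R)) :> R.
    rewrite mulrAC -natrM expRN mulrC expRM_natr lnK ?posrE// exprVn.
    by [].
  rewrite ler_expR lerN2 l2 natrM.
  by rewrite (_ : _ / 2 * _ = a%:R / 2 * (1 - (mu - 1) ^+ 2) * k%:R) ?ler_wpM2r//; ring.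
apply: (@le_trans _ _ (2 * (2 * J%:R * 2^-1 ^+ ((C + 4) * k)))).
  by rewrite ler_pM2l// ler_wpM2l.
have w1 : (1 <= w')%N by rewrite expn_gt0.
have Jle : (J <= 2 ^ (q + 2 + C + C * k))%N.
  have -> : (q + 2 + C + C * k = q + (2 + C * k.+1))%N by rewrite mulnS; lia.
  rewrite expnD /J leq_mul//; first by rewrite ltnW// ltn_expl.
  by rewrite expnD -/(w k.+1) -/w'; lia.
rewrite mulrA -mulrA; have J4 : (2 * 2 * J <= 2 ^ (q + 4 + C + C * k))%N.
  have -> : (q + 4 + C + C * k = 2 + (q + 2 + C + C * k))%N by lia.
  by rewrite expnD leq_mul2l Jle orbT.
rewrite !mulrA -!natrM -(@ler_pM2r _ (2 ^+ ((C + 4) * k))) ?exprn_gt0//.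
rewrite -mulrA -exprMn mulVf// expr1n mulr1.
have -> : 2 ^+ ((C + 4) * k) = 2 ^+ (3 * k + 1) * 2 ^+ ((C + 4) * k - (3 * k + 1)) :> R.
  by rewrite -exprD subnKC//; lia.
rewrite mulrA -exprMn mulVf// expr1n mul1r -natrX ler_nat.
apply: leq_trans J4 _; rewrite leq_exp2l//; lia.
Qed.


Lemma one_minus_expn_le (p : R) n : 0 <= p -> p <= 1 -> (1 - p) ^+ n <= expR (- (p * n%:R)).
Proof.
move=> p0 p1; rewrite -mulNr expRM_natr lerXn2r ?nnegrE ?expR_ge0 ?subr_ge0//.
exact: expR_ge1Dx.
Qed.

(* The number [2 ^ (C k)] of scales beats the probability [expR (- (b k / 2)
   - O(sqrt k))] of a large increment at each of them. *)
Lemma scales_beat_tail (b : R) : 0 <= b -> b / 2 < C%:R * ln 2 ->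
  exists k0, forall k, (k0 <= k)%N -> let l := 2 + Num.sqrt (b * k%:R) in
    l ^+ 4 <= k%:R ^+ 3 /\
    (3 * k + 1)%:R <= expR (- (l ^+ 2 / 2) - 2 * l) / 4 * 2 ^+ (C * k).
Proof.
move=> b0 bC; pose sb := Num.sqrt b.
have sb0 : 0 <= sb by exact: sqrtr_ge0.
have sb2 : b = sb ^+ 2 by rewrite sqr_sqrtr.
pose sg := C%:R * ln 2 - b / 2; have sg0 : 0 < sg by rewrite subr_gt0.
(* With t = sqrt k the logarithm of the product is t (sg t - 4 sb) - 6. The first summand makes this
   at least 7t - 6 >= t; t >= 20 then lets t^4 / 24 exceed 4 (3 t^2 + 1). *)
pose Y := (4 * sb + 7) / sg + 20.
have Y20 : 20 <= Y by rewrite lerDr divr_ge0 ?ltW//; lra.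
have [k0 k0P] := eventually_le_nat (Y ^+ 2 + (2 + sb) ^+ 4).
exists k0 => k /k0P kY l.
pose t : R := Num.sqrt k%:R.
have t2 : k%:R = t ^+ 2 by rewrite sqr_sqrtr.
have t0 : 0 <= t by exact: sqrtr_ge0.
have lE : l = 2 + sb * t by rewrite /l sqrtrM.
have b4 : 0 <= (2 + sb) ^+ 4 by rewrite exprn_ge0// addr_ge0.
have tY : Y <= t.
  rewrite -(@ler_pXn2r _ 2) ?nnegrE//; last lra.
  by rewrite -t2; lra.
have Y2 : 0 <= Y ^+ 2 by exact: sqr_ge0.
split.
  apply: (@le_trans _ _ (((2 + sb) * t) ^+ 4)).
    rewrite lerXn2r ?nnegrE ?mulr_ge0 ?lE ?addr_ge0 ?mulr_ge0//.
    rewrite mulrDl lerD2r; lra.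
  have t4 : t ^+ 4 = k%:R ^+ 2 by rewrite t2 -exprM.
  by rewrite exprMn t4 [leRHS]exprS ler_wpM2r ?sqr_ge0//; lra.
have e24 : 1 + t ^+ 4 / 24 <= expR t by exact: (@expR_ge1Dxn R t 3).
have tb : expR t <= expR (- (l ^+ 2 / 2) - 2 * l) * 2 ^+ (C * k).
  have -> : 2 ^+ (C * k) = expR (C%:R * ln 2 * k%:R) :> R.
    by rewrite mulrAC -natrM mulrC expRM_natr lnK ?posrE.
  rewrite -expRD ler_expR.
  have -> : - (l ^+ 2 / 2) - 2 * l + C%:R * ln 2 * k%:R =
      t * (sg * t - 4 * sb) - 6.
    by rewrite /sg lE t2 sb2; field.
  have h : 4 * sb + 7 <= sg * t.
    rewrite [leRHS]mulrC -ler_pdivrMr//; apply: le_trans tY; rewrite lerDl; lra.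
  have : t * 7 <= t * (sg * t - 4 * sb) by rewrite ler_wpM2l//; lra.
  lra.
rewrite mulrAC ler_pdivlMr// (le_trans _ tb)// (le_trans _ e24)//.
rewrite natrD natrM t2; have t20 : 20 <= t by exact: le_trans tY.
have h2 : 400 <= t ^+ 2 by rewrite expr2; nra.
rewrite (_ : t ^+ 4 = t ^+ 2 * t ^+ 2); last by ring.
by move: (t ^+ 2) h2 => u; nra.
Qed.

(** Consecutive blocks have ratio 2^g, so the part of a block beyond the next shorter one is a
    proportion 1 - 2^-g of it and is independent of the shorter one. In standard deviations of that
    part the threshold is sqrt (a k / (1 - 2^-g)), whence the hypothesis. *)
Lemma too_small_prob : (0 < C)%N -> (0 < g)%N ->
  a%:R / (1 - 2^-1 ^+ g) / 2 < C%:R * ln (2 : R) ->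
  exists k0, forall k i, (k0 <= k)%N -> (i < N k)%N ->
    Ex R (N k) (fun s => (too_small psi C g a k (nat_of_bits s) i)%:R) <= 2^-1 ^+ (3 * k + 1).
Proof.
move=> C0 g0 aC; set r := 1 - _ in aC.
have r0 : 0 < r by rewrite subr_gt0 exprn_ilt1 -?lt0n //; lra.
have [k0 k0P] := scales_beat_tail _ (divr_ge0 (ler0n R a) (ltW r0)) aC.
exists k0 => k i /k0P[l4 big] iN.
set l := 2 + _ in l4 big.
set n := N k in iN *; set w' := w k.+1; set M := (n %/ 2 ^ (g * w'))%N.
have l0 : 0 <= l by rewrite addr_ge0// sqrtr_ge0.
have kw : (w k + 2 ^ (C * k) <= w')%N.
  rewrite addnn -mul2n -expnS /w' /scale leq_exp2l// mulnS -addn1 addnC leq_add2r; lia.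
have kw' : (k <= w')%N.
  apply: leq_trans (ltnW (ltn_expl k (isT : (1 < 2)%N))) _.
  rewrite /w' /scale leq_exp2l//; apply: leq_trans (leqnSn k) _; exact: leq_pmull.
have nE : n = (2 ^ (g * w') * (2 ^ (g * w') * 4 ^ k * (psi (precision C g k)).+1))%N.
  rewrite /n /resolution /precision -/w' expnD (_ : 4 = 2 ^ 2)%N// -!expnM mulnAC mul2n -addnn.
  by rewrite expnD !mulnA; lia.
have M_E : M = (2 ^ (g * w') * 4 ^ k * (psi (precision C g k)).+1)%N.
  by rewrite /M nE mulKn// expn_gt0.
have nM : n = (2 ^ (g * w') * M)%N by rewrite M_E nE.
(* Even the shortest piece is long enough for [walk_lower_tail], as [scales_beat_tail] gives l^4 <=
   k^3. *)
have M3 : (k ^ 3 <= M)%N.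
  rewrite M_E expnS -mulnA leq_mul//.
    apply: leq_trans (ltnW (ltn_expl k (isT : (1 < 2)%N))) _.
    by rewrite leq_exp2l//; apply: leq_trans kw' _; rewrite leq_pmull.
  apply: (@leq_trans (4 ^ k)); last by rewrite leq_pmulr.
  rewrite (_ : 4 = 2 ^ 2)%N// -expnM mulnC expnM leq_exp2r//.
  exact: ltnW (ltn_expl k (isT : (1 < 2)%N)).
have M0 : (0 < M)%N by rewrite M_E !muln_gt0 !expn_gt0.
(* Blocks in increasing length, the reverse of the order in [too_small]: a walk reaches the short
   ones first. *)
pose m j := (n %/ 2 ^ (g * (w' - j)))%N.
have mE j : (j <= w')%N -> m j = (2 ^ (g * j) * M)%N.
  move=> jw; rewrite /m nM -{1}(subnK jw) mulnDr expnD -mulnA mulKn// expn_gt0//.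
have mm : {homo m : i j / (i <= j)%N}.
  by move=> j1 j2 j12; rewrite /m leq_div2l ?expn_gt0// leq_exp2l// leq_mul2l leq_sub2l// orbT.
set nb := (w' - w k)%N.
have nbw : (nb <= w')%N by exact: leq_subr.
have nbC : (2 ^ (C * k) <= nb)%N by rewrite leq_subRL ?(leq_trans (leq_addr _ _) kw).
have nb0 : (0 < nb)%N by apply: leq_trans nbC; rewrite expn_gt0.
have blockE j : (j < nb)%N -> block psi C g k (nb - j.+1) = m j.+1.
  by move=> jn; rewrite /block /m -/n; congr (n %/ 2 ^ (g * _))%N; rewrite /nb in jn *; lia.
pose x j : R := Num.sqrt (a * k * m j.+1)%:R.
pose p : R := expR (- (l ^+ 2 / 2) - 2 * l) / 4.
have p0 : 0 <= p by rewrite divr_ge0// expR_ge0.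
have p1 : p <= 1.
  rewrite ler_pdivrMr// mul1r; apply: (@le_trans _ _ 1); last by rewrite ler1n.
  rewrite -[leRHS]expR0 ler_expR; have := sqr_ge0 l; clearbody l; lra.
have pE j : (j < nb)%N -> p <= Ex R (m j.+1 - m j) (fun s => (x j <= walk R s)%R%:R).
  move=> jn; have jw : (j < w')%N by exact: leq_trans jn nbw.
  set d := (m j.+1 - m j)%N.
  have dM : (M <= d)%N.
    rewrite /d (mE _ jw) (mE _ (ltnW jw)) -mulnBl leq_pmull// subn_gt0 ltn_exp2l//.
    by rewrite mulnS -addn1 addnC leq_add2r.
  have dE : d%:R = (m j.+1)%:R * r :> R.
    rewrite /d natrB ?mm// (mE _ jw) (mE _ (ltnW jw)) !natrM mulnS expnD natrM !natrX /r exprVn.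
    by field; rewrite expf_eq0 pnatr_eq0 andbF.
  have -> : x j = (l - 2) * Num.sqrt d%:R.
    rewrite /l addrC addKr dE -sqrtrM; last by rewrite mulr_ge0// divr_ge0// ltW.
    by congr Num.sqrt; rewrite !natrM; field; rewrite gt_eqF.
  rewrite /p; apply: (walk_lower_tail R d l) => //; first exact: leq_trans dM.
  by apply: le_trans l4 _; rewrite -natrX ler_nat; exact: leq_trans dM.
have fin : (1 - p) ^+ nb <= 2^-1 ^+ (3 * k + 1).
  apply: le_trans (one_minus_expn_le _ _ p0 p1) _.
  have e1 : expR (- 1) <= 2^-1 :> R.
    by rewrite expRN lef_pV2 ?posrE ?expR_gt0//; apply: le_trans (expR_ge1Dx _).
  apply: (@le_trans _ _ (expR (- 1) ^+ (3 * k + 1))); last first.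
    by rewrite lerXn2r ?nnegrE ?expR_ge0.
  rewrite -expRM_natr ler_expR mulN1r lerN2; apply: le_trans big _.
  by rewrite ler_wpM2l// -natrX ler_nat.
apply: le_trans fin.
(* If the longest block, which has index 0 in the test, leaves the grid, the test is false and the
   probability is 0. *)
have [inb|inb] := leqP (i + m nb) n; last first.
  apply: (@le_trans _ _ (Ex R n (fun=> 0))); last by rewrite Ex_cst exprn_ge0 ?subr_ge0.
  apply: Ex_le => s sn; case: (boolP (too_small _ _ _ _ _ _ _)) => // /forallP.
  move=> /(_ (Ordinal nb0)) /= /andP[+ _].
  rewrite (_ : 0 = nb - nb.-1.+1)%N; last by rewrite prednK// subnn.
  by rewrite blockE ?prednK// leqNgt inb.
apply: le_trans (walk_small_blocks R m x p nb mm p1 pE).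
pose G t := ([forall j : 'I_nb, `|walk R (take (m j.+1) t)| < x j]%:R : R).
have mn : (m nb <= n - i)%N by rewrite leq_subRL// ltnW.
rewrite -(@Ex_take _ (n - i)%N (m nb) G)// -(@Ex_drop _ n i (fun t => G (take (m nb) t))) 1?ltnW//.
apply: Ex_le => s sn; rewrite /G ler_nat.
case: (boolP (too_small _ _ _ _ _ _ _)) => // /forallP sm; rewrite lt0b.
apply/forallP => j; have jn := ltn_ord j.
have jlt : (nb - j.+1 < nb)%N by rewrite ltn_subrL.
have /andP[bn] := sm (Ordinal jlt); rewrite /= in bn *.
rewrite blockE// in bn *; rewrite take_takel ?mm//.
rewrite -(ltr_nat R) natrX displacementE ?sn ?(ltnW iN)//.
rewrite takeD walk_cat addrAC subrr add0r => h.
rewrite -(@ltr_pXn2r _ 2) ?nnegrE ?sqrtr_ge0//.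
by rewrite sqr_sqrtr.
Qed.

End TestBounds.

(** * Walks approximating an oscillation *)

Section Approximation.
Variable R : realType.
Implicit Types (x y omega : R -> R) (n : nat) (t : R).

Lemma le_unorm (f : R -> R) t : C01 f -> 0 <= t <= 1 -> `|f t| <= unorm f.
Proof.
move=> cf t01; apply: ub_le_sup; last by exists t => //=; rewrite in_itv.
have cn : {within `[0, 1], continuous (fun s => `|f s|)}.
  by move=> s; apply: cvg_norm; exact: cf.
have [c _ cmax] := EVT_max ler01 cn.
by exists `|f c| => _ [s s01 <-]; apply: cmax.
Qed.

Section Grid.
Variables (x : R -> R) (n : nat).
Hypotheses (n0 : (0 < n)%N) (xC : Cn n x).

Let s := slope_code n x.
Let sq : R := Num.sqrt n%:R.

Let sq0 : 0 < sq. Proof. by rewrite sqrtr_gt0 ltr0n. Qed.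
Let sq2 : n%:R = sq ^+ 2. Proof. by rewrite sqr_sqrtr. Qed.
Let nR0 : 0 < (n%:R : R). Proof. by rewrite ltr0n. Qed.

Let subintervalP i t :
  @subinterval R n i t <-> i%:R / n%:R <= t <= i.+1%:R / n%:R.
Proof. by rewrite /subinterval /= in_itv. Qed.

Let node_lt i : i%:R / n%:R < i.+1%:R / n%:R :> R.
Proof. by rewrite ltr_pM2r ?invr_gt0// ltr_nat. Qed.

Lemma Cn_affine i : (i < n)%N -> exists b : R, forall t,
  i%:R / n%:R <= t <= i.+1%:R / n%:R -> x t = step R (nth false s i) * sq * t + b.
Proof.
move=> ilt; rewrite /s nth_mkseq//.
have [_ _ /(_ i ilt)[[b bP]|[b bP]]] := xC; exists b => t /subintervalP ti; rewrite bP//.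
  suff -> : `[< increasing_on x (@subinterval R n i) >] = true by rewrite mul1r.
  by apply/asboolP => u v ui vi uv; rewrite !bP// ltrD2r ltr_pM2l.
suff -> : `[< increasing_on x (@subinterval R n i) >] = false by rewrite mulN1r.
apply/asboolP => /(_ (i%:R / n%:R) (i.+1%:R / n%:R)).
have u : @subinterval R n i (i%:R / n%:R) by apply/subintervalP; rewrite lexx ltW.
have v : @subinterval R n i (i.+1%:R / n%:R) by apply/subintervalP; rewrite lexx ltW.
move=> /(_ u v (node_lt i)); rewrite !bP// ltrD2r !mulNr ltrN2.
by rewrite ltr_pM2l// ltNge ltW.
Qed.

Let stepn : sq / n%:R = 1 / sq.
Proof. by rewrite sq2; field; rewrite gt_eqF. Qed.

Lemma Cn_node i : (i <= n)%N -> x (i%:R / n%:R) = walk R (take i s) / sq.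
Proof.
elim: i => [_|i IH ilt].
  by have [_ x0 _] := xC; rewrite mul0r x0 take0 walk_nil mul0r.
have [b bP] := Cn_affine i ilt.
have ss : (i < size s)%N by rewrite size_mkseq.
rewrite (take_nth false ss) -cats1 walk_cat walk_cons walk_nil addr0.
have x1 : x (i%:R / n%:R) = step R (nth false s i) * sq * (i%:R / n%:R) + b.
  by apply: bP; rewrite lexx ltW.
have x2 : x (i.+1%:R / n%:R) = step R (nth false s i) * sq * (i.+1%:R / n%:R) + b.
  by apply: bP; rewrite lexx ltW.
rewrite [RHS]mulrDl -(IH (ltnW ilt)) x1 x2 -!mulrA.
have -> : sq * (i.+1%:R / n%:R) = sq * (i%:R / n%:R) + 1 / sq.
  by rewrite -stepn -natr1; ring.
ring.
Qed.

Lemma Cn_near_node i t : (i < n)%N -> i%:R / n%:R <= t <= i.+1%:R / n%:R ->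
  `|x t - walk R (take i s) / sq| <= 1 / sq.
Proof.
move=> ilt ti; rewrite -(Cn_node i (ltnW ilt)).
have [b bP] := Cn_affine i ilt.
have x1 : x (i%:R / n%:R) = step R (nth false s i) * sq * (i%:R / n%:R) + b.
  by apply: bP; rewrite lexx ltW.
rewrite (bP t ti) x1.
rewrite [X in `|X|](_ : _ = step R (nth false s i) * (sq * (t - i%:R / n%:R))); last by ring.
have step1 : `|step R (nth false s i)| = 1 by rewrite /step; case: ifP; rewrite ?normrN normr1.
have /andP[t1 t2] := ti.
rewrite normrM step1 [leLHS]mul1r ger0_norm; last first.
  by apply: mulr_ge0; [exact: ltW|rewrite subr_ge0].
rewrite -stepn; apply: ler_wpM2l; first exact: ltW.
rewrite lerBlDr; apply: le_trans t2 _.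
by rewrite -natr1 mulrDl mul1r addrC.
Qed.

Lemma Cn_truncn t : 0 <= t <= 1 ->
  `|x t - walk R (take (Num.truncn (n%:R * t)) s) / sq| <= 1 / sq.
Proof.
(* At t = 1 the truncation is n, which is the index of a node but not of a subinterval. *)
move=> /andP[t0]; rewrite le_eqVlt => /orP[/eqP ->|t1].
  rewrite mulr1 natrK -Cn_node// divff ?gt_eqF// subrr normr0.
  by rewrite divr_ge0// ltW.
have nt0 : 0 <= n%:R * t by rewrite mulr_ge0.
have /andP[h1 h2] := truncn_itv nt0.
apply: Cn_near_node.
  by rewrite -(ltr_nat R) (le_lt_trans h1)// gtr_pMr.
by rewrite ler_pdivrMr// ler_pdivlMr// [t * _]mulrC h1 ltW.
Qed.

End Grid.

Lemma slope_code_approximation omega x n (e : R) t : C01 omega -> (0 < n)%N -> Cn n x ->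
  unorm (fun t => x t - omega t) <= e -> 1 / Num.sqrt n%:R <= e -> 0 <= t <= 1 ->
  `|omega t - walk R (take (Num.truncn (n%:R * t)) (slope_code n x)) / Num.sqrt n%:R| <= 2 * e.
Proof.
move=> co n0 xC xo ne t01.
have cd : C01 (fun t => x t - omega t).
  by have [cx _ _] := xC; move=> s; apply: cvgB; [exact: cx|exact: co].
have h1 := le_trans (le_unorm _ _ cd t01) xo.
have h2 := le_trans (Cn_truncn _ _ n0 xC _ t01) ne.
rewrite (_ : 2 * e = e + e); last by ring.
apply: le_trans (lerD h1 h2).
set v := walk _ _ / _; rewrite distrC /=.
have -> : v - omega t = (x t - omega t) - (x t - v) by ring.
exact: ler_normB.
Qed.

End Approximation.

(** * From grid points to almost every time *)

Lemma ae_eventually_good (R : realType) (N : nat -> nat) (G : nat -> nat -> bool) (K : nat) :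
  (forall k, (0 < N k)%N) ->
  (forall k, (K <= k)%N -> (2 ^ k * \sum_(i < N k) G k i < N k)%N) ->
  {ae @lebesgue_measure R, forall t : R, 0 <= t < 1 ->
    exists K', forall k, (K' <= k)%N -> ~~ G k (Num.truncn ((N k)%:R * t))}.
Proof.
move=> N0 few.
pose cell k i : set R := if G k i then `[i%:R / (N k)%:R, i.+1%:R / (N k)%:R[%classic else set0.
pose T k : set R := if (K <= k)%N then \big[setU/set0]_(i < N k) cell k i else set0.
have mc k i : measurable (cell k i) by rewrite /cell; case: ifP.
have mT k : measurable (T k).
  by rewrite /T; case: ifP => // _; apply: bigsetU_measurable.
have NR k : 0 < ((N k)%:R : R) by rewrite ltr0n.
have muc k i : lebesgue_measure (cell k i) = ((G k i)%:R / (N k)%:R)%:E.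
  rewrite /cell; case: ifP => _; last by rewrite measure0 mul0r.
  rewrite lebesgue_measure_itv /= lte_fin ltr_pM2r ?invr_gt0// ltr_nat ltnSn.
  by rewrite -EFinB -mulrBl -natr1 addrAC subrr add0r.
(* The union of bad cells has measure at most 2^-k, written in the form summed by
   [epsilon_trick0]. *)
have muT k : (lebesgue_measure (T k) <= (2 / (2 ^ k.+1)%:R)%:E)%E.
  rewrite /T; case: ifP => [Kk|_]; last by rewrite measure0 lee_fin divr_ge0.
  have := @Boole_inequality _ _ _ (@lebesgue_measure R) (cell k) (N k) (fun i _ => mc k i).
  move/le_trans; apply.
  rewrite (eq_bigr (fun i : 'I_(N k) => ((G k i)%:R / (N k)%:R)%:E)); last by move=> i _; exact: muc.
  rewrite sumEFin lee_fin -mulr_suml ler_pdivrMr// mulrAC.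
  rewrite ler_pdivlMr ?ltr0n ?expn_gt0// -natr_sum -!natrM ler_nat expnS mulnCA leq_mul2l /=.
  by rewrite mulnC; exact/ltnW/few.
have neg : lebesgue_measure (lim_sup_set T) = 0%E.
  apply: lim_sup_set_cvg0 => //.
  apply: (@le_lt_trans _ _ (\sum_(k <oo) (2 / (2 ^ k.+1)%:R)%:E)%E); last first.
    by apply: le_lt_trans (epsilon_trick0 _ _) (ltry _).
  by apply: lee_nneseries => [k _ _|k _]; [exact: measure_ge0|exact: muT].
exists (lim_sup_set T); split => //.
  apply: bigcap_measurable => // n _.
  by apply: bigcup_measurable => k _; exact: mT.
move=> t /= /not_implyP[/andP[t0 t1] bad] n _.
apply: contrapT => nT; apply: bad; exists (maxn K n) => k.
rewrite geq_max => /andP[Kk nk]; apply/negP => Gk; apply: nT.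
exists k => //; rewrite /T Kk -bigcup_mkord.
have Nt : 0 <= (N k)%:R * t by rewrite mulr_ge0.
have /andP[h1 h2] := truncn_itv Nt.
exists (Num.truncn ((N k)%:R * t)) => /=.
  by rewrite -(ltr_nat R) (le_lt_trans h1)// gtr_pMr.
by rewrite /cell Gk /= in_itv /= ler_pdivrMr// ltr_pdivlMr// [t * _]mulrC h1.
Qed.

(** * Comparison of the thresholds with the iterated logarithm *)

Lemma sqrt_natr_small (R : realType) (al be ga : R) : 0 < al ->
  exists k0, forall k, (k0 <= k)%N -> be * Num.sqrt k%:R + ga <= al * k%:R.
Proof.
move=> al0; pose Y := (`|be| + `|ga|) / al + 1.
have q0 : 0 <= (`|be| + `|ga|) / al by rewrite divr_ge0 ?addr_ge0// ltW.
have [k0 k0P] := eventually_le_nat R (Y ^+ 2).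
exists k0 => k /k0P kY; set t := Num.sqrt _.
have t0 : 0 <= t by exact: sqrtr_ge0.
have tY : Y <= t by rewrite -(@ler_pXn2r _ 2) ?nnegrE ?sqr_sqrtr// /Y addr_ge0.
have t1 : 1 <= t by apply: le_trans tY; rewrite lerDr.
have h : `|be| + `|ga| <= al * t.
  by rewrite [leRHS]mulrC -ler_pdivrMr//; apply: le_trans tY; rewrite lerDl.
have -> : al * k%:R = al * t * t by rewrite -mulrA -expr2 sqr_sqrtr.
have b1 : be <= `|be| by exact: ler_norm.
have g1 : ga <= `|ga| by exact: ler_norm.
have g0 : 0 <= `|ga| by [].
have := ler_wpM2r t0 h; have := ler_wpM2r t0 b1; have := ler_wpM2l g0 t1; nra.
Qed.

Lemma ln2_ge (R : realType) : 2^-1 <= ln 2 :> R.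
Proof.
rewrite -ler_expR lnK ?posrE// -[leRHS]invrK -[leLHS]invrK lef_pV2 ?posrE ?invr_gt0 ?expR_gt0//.
by rewrite -expRN; apply: le_trans (expR_ge1Dx _); lra.
Qed.

(** In units of sqrt |h|, the 5 is made of 4 for replacing omega by the walk at both ends and 1 for
    rounding the increment to the grid. The bracket is log log (1/|h|) at the coarse end |h| =
    2^-w(k). *)
Lemma sqrt_tail_le (R : realType) (C a : nat) (de : R) : 0 < de ->
  a%:R < (1 + de) ^+ 2 * (2 * C%:R * ln 2) ->
  exists k0, forall k, (k0 <= k)%N ->
    (Num.sqrt (a * k)%:R + 5) ^+ 2 <= (1 + de) ^+ 2 * (2 * (C%:R * k%:R * ln 2 + ln (ln 2))).
Proof.
move=> de0 aC; set A := (1 + de) ^+ 2 in aC *.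
have al0 : 0 < A * (2 * C%:R * ln 2) - a%:R by rewrite subr_gt0.
have [k0 k0P] := sqrt_natr_small _ _ (10 * Num.sqrt a%:R) (25 - A * 2 * ln (ln 2)) al0.
exists k0 => k /k0P.
rewrite natrM sqrtrM// sqrrD exprMn !sqr_sqrtr// mulrBl => h.
by rewrite (_ : 5 ^+ 2 = 25 :> R); [lra|rewrite -natrX].
Qed.

(** Block lengths are exact on the grid, so only the approximation error 4 remains. The bracket is
    log log (1/h) at h = 2^-(g w(k+1)), beyond the finest block. *)
Lemma sqrt_tail_ge (R : realType) (C g a : nat) (de : R) :
  (1 - de) ^+ 2 * (2 * C%:R * ln 2) < a%:R ->
  exists k0, forall k, (k0 <= k)%N -> 4 <= Num.sqrt (a * k)%:R :> R /\
    (1 - de) ^+ 2 * (2 * (C%:R * k.+1%:R * ln 2 + ln (g%:R * ln 2))) <=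
    (Num.sqrt (a * k)%:R - 4) ^+ 2.
Proof.
move=> aC; set A := (1 - de) ^+ 2 in aC *.
have l2 := ln2_ge R.
have a0 : 0 < (a%:R : R).
  apply: le_lt_trans aC; apply: mulr_ge0; first exact: sqr_ge0.
  by rewrite !mulr_ge0//; lra.
have al0 : 0 < a%:R - A * (2 * C%:R * ln 2) by rewrite subr_gt0.
have [k0 k0P] := sqrt_natr_small _ _ (8 * Num.sqrt a%:R)
  (A * 2 * ln (g%:R * ln 2) + A * 2 * C%:R * ln 2) al0.
exists (maxn k0 16) => k; rewrite geq_max => /andP[/k0P h k16]; split.
  rewrite -(@ler_pXn2r _ 2) ?nnegrE ?sqrtr_ge0// sqr_sqrtr// -natrX ler_nat.
  apply: leq_trans k16 _; rewrite leq_pmull//.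
  by rewrite -(ltr_nat R).
move: h; rewrite natrM sqrtrM// sqrrB exprMn !sqr_sqrtr// mulrBl => h.
by rewrite -natr1 (_ : 4 ^+ 2 = 16 :> R); [lra|rewrite -natrX].
Qed.

(** * Consequences of passing the tests at a given time *)

Section Pointwise.
Variables (R : realType) (psi : nat -> nat) (C g a : nat).
Variables (omega : R -> R) (x_ : nat -> R -> R).
Hypothesis C_omega : C01 omega.
Hypothesis Cn_x : forall n, (0 < n)%N -> Cn n (x_ n).
Hypothesis x_omega : forall k n, (0 < n)%N -> (psi k <= n)%N ->
  unorm (fun t => x_ n t - omega t) <= 2^-1 ^+ k.
Hypotheses (C_gt0 : (0 < C)%N) (g_gt0 : (0 < g)%N).

Local Notation N := (resolution psi C g).
Local Notation w := (scale C).
Local Notation prec := (precision C g).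

Definition path_code k := nat_of_bits (slope_code (N k) (x_ (N k))).

Definition grid_index k (t : R) := Num.truncn ((N k)%:R * t).

Let NR k : 0 < ((N k)%:R : R). Proof. by rewrite ltr0n resolution_gt0. Qed.

Let grid_index_itv k t : 0 <= t -> (grid_index k t)%:R <= (N k)%:R * t < (grid_index k t).+1%:R.
Proof. by move=> t0; apply: truncn_itv; rewrite mulr_ge0. Qed.

Let grid_index_le k t : 0 <= t <= 1 -> (grid_index k t <= N k)%N.
Proof.
move=> /andP[t0 t1]; rewrite -(ler_nat R); have /andP[h _] := grid_index_itv k _ t0.
by apply: le_trans h _; rewrite -[leRHS]mulr1 ler_wpM2l.
Qed.

Let sqrtN_ge k : 2 ^+ prec k <= Num.sqrt (N k)%:R :> R.
Proof.
rewrite -(@ler_pXn2r _ 2) ?nnegrE ?sqrtr_ge0 ?exprn_ge0// sqr_sqrtr//.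
by rewrite -exprM mulnC exprM -natrX -natrX ler_nat /resolution leq_pmulr.
Qed.

Lemma increment_approx k (t u : R) : 0 <= t <= 1 -> 0 <= u <= 1 ->
  `| `|omega u - omega t| -
     (displacement (path_code k) (grid_index k t) (grid_index k u))%:R / Num.sqrt (N k)%:R |
  <= 4 * 2^-1 ^+ prec k.
Proof.
move=> t01 u01; set e := 2^-1 ^+ prec k.
have n0 := resolution_gt0 psi C g k.
have psiN : (psi (prec k) <= N k)%N.
  by apply: leq_trans (leqnSn _) _; rewrite leq_pmull// expn_gt0.
have sN0 : 0 < Num.sqrt (N k)%:R :> R by rewrite sqrtr_gt0.
have se : 1 / Num.sqrt (N k)%:R <= e.
  by rewrite mul1r /e exprVn lef_pV2 ?posrE ?exprn_gt0.
have A s := slope_code_approximation R omega _ _ e s C_omega n0 (Cn_x _ n0) (x_omega _ _ n0 psiN) se.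
rewrite /path_code displacementE ?size_mkseq ?grid_index_le//.
set S := fun i => walk R (take i (slope_code (N k) (x_ (N k)))).
have At : `|omega t - S (grid_index k t) / Num.sqrt (N k)%:R| <= 2 * e by exact: A.
have Au : `|omega u - S (grid_index k u) / Num.sqrt (N k)%:R| <= 2 * e by exact: A.
have absE (v : R) : `|v| / Num.sqrt (N k)%:R = `|v / Num.sqrt (N k)%:R|.
  by rewrite normrM [`|_^-1|]ger0_norm// invr_ge0 ltW.
rewrite absE; apply: le_trans (ler_dist_dist _ _) _.
rewrite [X in `|X|](_ : _ = (omega u - S (grid_index k u) / Num.sqrt (N k)%:R) -
   (omega t - S (grid_index k t) / Num.sqrt (N k)%:R)); last by rewrite /S; ring.
by apply: le_trans (ler_normB _ _) _; lra.
Qed.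

Lemma distn_natr (i j : nat) : ((i - j) + (j - i))%N%:R = `|j%:R - i%:R| :> R.
Proof.
have [h|/ltnW h] := leqP i j.
  by rewrite (eqP h) add0n natrB// ger0_norm// subr_ge0 ler_nat.
by rewrite (eqP h) addn0 natrB// distrC ger0_norm// subr_ge0 ler_nat.
Qed.

Let leq_scale k : (k <= w k)%N.
Proof.
apply: leq_trans (ltnW (ltn_expl k (isT : (1 < 2)%N))) _.
by rewrite leq_exp2l// leq_pmull.
Qed.

Let leq_scale_scale k l : (k <= l)%N -> (w k <= w l)%N.
Proof. by move=> kl; rewrite leq_exp2l// leq_mul2l kl orbT. Qed.

Let half_le (m n : nat) : (m <= n)%N -> 2^-1 ^+ n <= 2^-1 ^+ m :> R.
Proof. by move=> mn; rewrite ler_wiXn2l//; lra. Qed.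

Lemma find_scale k1 (h : R) : 0 < h -> h < 2^-1 ^+ w k1 ->
  exists2 k, (k1 <= k)%N & 2^-1 ^+ w k.+1 <= h < 2^-1 ^+ w k.
Proof.
move=> h0 hk1.
have ex : exists k, 2^-1 ^+ w k <= h.
  have [k kP] := eventually_le_nat R h^-1.
  exists k; apply: le_trans (half_le _ _ (leq_scale k)) _.
  rewrite exprVn -[leRHS]invrK lef_pV2 ?posrE ?invr_gt0 ?exprn_gt0//.
  apply: le_trans (kP k (leqnn k)) _; rewrite -natrX ler_nat.
  exact/ltnW/ltn_expl.
case: (ex_minnP ex) => -[|k] kh kmin.
  have := lt_le_trans hk1 (half_le _ _ (leq_scale_scale _ _ (leq0n k1))).
  by rewrite ltNge kh.
exists k; last by rewrite kh /= ltNge; apply/negP => /kmin; rewrite ltnn.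
rewrite leqNgt; apply/negP => kk1.
have := lt_le_trans hk1 (half_le _ _ (leq_scale_scale _ _ kk1)).
by rewrite ltNge kh.
Qed.

Lemma lil_le (de t : R) : 0 < de -> 0 <= t <= 1 ->
  a%:R < (1 + de) ^+ 2 * (2 * C%:R * ln 2) ->
  (exists K, forall k, (K <= k)%N -> ~~ too_large psi C g a k (path_code k) (grid_index k t)) ->
  exists2 r : R, 0 < r & forall h, h != 0 -> `|h| < r -> 0 <= t + h <= 1 ->
    lil_ratio omega t h <= 1 + de.
Proof.
move=> de0 t01 aC [K good]; have [k0 k0P] := sqrt_tail_le _ _ _ _ de0 aC.
(* Below this radius the window index exceeds K, k0 and a, and is positive. *)
exists (2^-1 ^+ w (K + k0 + a + 1)); first by rewrite exprn_gt0.
move=> h hn0; rewrite -normr_gt0 in hn0; set hh := `|h| in hn0 *.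
move=> /(find_scale _ _ hn0)[k kK /andP[hw' hw]] th01.
have Kk : (K <= k)%N by lia.
have k0k : (k0 <= k)%N by lia.
have ak : (a <= k)%N by lia.
have k_gt0 : (0 < k)%N by lia.
have hh1 : hh <= 1 by apply: le_trans (ltW hw) _; rewrite -[leRHS](expr0 2^-1) half_le.
set n := N k; set i := grid_index k t; set j := grid_index k (t + h).
have e_le : 2^-1 ^+ prec k <= hh.
  apply: le_trans (half_le _ _ _) hw'.
  by apply: leq_trans (leq_addr _ _); rewrite leq_pmull.
have nhh : 2 ^+ prec k <= n%:R * hh.
  apply: (@le_trans _ _ (n%:R * 2^-1 ^+ prec k)); last by rewrite ler_wpM2l.
  rewrite exprVn ler_pdivlMr ?exprn_gt0// -expr2 -exprM mulnC exprM -natrX -natrX.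
  by rewrite ler_nat /n /resolution leq_pmulr.
have p2 : 2 <= 2 ^+ prec k :> R.
  rewrite -{1}(expr1 2) ler_eXn2l ?ltr1n//.
  by rewrite (leq_trans k_gt0)// leq_addl.
(* Rounding changes the number of steps by at most 1, hence the threshold by at most [a * k]; this
   must stay below N |h| to cost only 1 in [sa + 1]. *)
have akp : (a * k)%:R <= 2 ^+ prec k :> R.
  rewrite -natrX ler_nat /precision expnD leq_mul//.
    apply: leq_trans ak _; apply: leq_trans (leq_scale k) _.
    apply: leq_trans (leq_scale_scale _ _ (leqnSn k)) _.
    by apply: leq_trans (ltnW (ltn_expl _ (isT : (1 < 2)%N))) _; rewrite leq_exp2l// leq_pmull.
  exact/ltnW/ltn_expl.
have t0 : 0 <= t by case/andP: t01.
have th0 : 0 <= t + h by case/andP: th01.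
have /andP[i1 i2] := grid_index_itv k _ t0; have /andP[j1 j2] := grid_index_itv k _ th0.
rewrite -/n -/i -/j -!natr1 in i1 i2 j1 j2.
set d := ((i - j) + (j - i))%N.
have dn : `|d%:R - n%:R * hh| <= 1.
  rewrite /d distn_natr /hh -[n%:R]ger0_norm// -normrM.
  apply: le_trans (ler_dist_dist _ _) _.
  by rewrite ler_norml; apply/andP; split; move: i1 i2 j1 j2; rewrite mulrDr; lra.
move: dn; rewrite ler_norml => /andP[d1 d2].
have := good k Kk; rewrite negb_exists => /forallP.
have jn : (j < n.+1)%N by rewrite ltnS grid_index_le.
move=> /(_ (Ordinal jn)) /=; rewrite -/n -/i -/d.
have c1 : (n <= 2 * d * 2 ^ w k.+1)%N.
  rewrite -(ler_nat R) (_ : (2 * d * 2 ^ w k.+1)%:R = 2 * d%:R * 2 ^+ w k.+1 :> R).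
  apply: (@le_trans _ _ (n%:R * hh * 2 ^+ w k.+1)); last first.
    by rewrite ler_wpM2r ?exprn_ge0//; lra.
  rewrite -mulrA ler_peMr//.
  by move: hw'; rewrite exprVn -ler_pdivrMr ?exprn_gt0// div1r.
  by rewrite natrM natrM natrX.
have c2 : (d * 2 ^ w k <= 2 * n)%N.
  rewrite -(ler_nat R) (_ : (d * 2 ^ w k)%:R = d%:R * 2 ^+ w k :> R).
  rewrite (natrM _ 2 n); apply: (@le_trans _ _ (2 * n%:R * hh * 2 ^+ w k)).
    by rewrite ler_wpM2r ?exprn_ge0//; lra.
  rewrite -mulrA ler_piMr ?mulr_ge0//.
  by move: (ltW hw); rewrite exprVn -ler_pdivlMr ?exprn_gt0// div1r.
  by rewrite natrM natrX.
rewrite c1 c2 /= -ltnNge; set D := displacement _ _ _ => Dd.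
have n0 : 0 < (n%:R : R) by exact: NR.
have sn0 : 0 < Num.sqrt n%:R :> R by rewrite sqrtr_gt0.
set sh := Num.sqrt hh; pose sa : R := Num.sqrt (a * k)%:R.
have sh0 : 0 < sh by rewrite sqrtr_gt0.
have sh2 : sh ^+ 2 = hh by rewrite sqr_sqrtr// ltW.
have shge0 := ltW sh0.
have sh1 : sh <= 1 by rewrite -(@expr_le1 _ 2) ?sh2.
have sa0 : 0 <= sa by exact: sqrtr_ge0.
have sa2 : sa ^+ 2 = (a * k)%:R by rewrite sqr_sqrtr.
have Dle : D%:R / Num.sqrt n%:R <= sh * (sa + 1).
  rewrite -(@ler_pXn2r _ 2) ?nnegrE ?divr_ge0 ?mulr_ge0 ?addr_ge0 ?sqrtr_ge0//.
  rewrite expr_div_n exprMn sqr_sqrtr// sh2 ler_pdivrMr//.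
  apply: (@le_trans _ _ ((a * k)%:R * d%:R)).
    by rewrite -natrX -natrM ler_nat ltnW.
  apply: (@le_trans _ _ ((a * k)%:R * (n%:R * hh + 1))).
    by rewrite ler_wpM2l//; lra.
  have : 0 <= sa * (hh * n%:R) by rewrite !mulr_ge0// ltW.
  have : (a * k)%:R <= n%:R * hh by exact: le_trans nhh.
  rewrite sqrrD sa2 expr1n mulr1; lra.
have inc : `|omega (t + h) - omega t| <= sh * (sa + 5).
  have := increment_approx k _ _ t01 th01; rewrite -/i -/j -/n -/D ler_norml => /andP[_ h2].
  have : hh <= sh by rewrite -sh2 expr2 ler_piMr// ltW.
  lra.
have tail := k0P k k0k; rewrite -/sa in tail.
set L0 := C%:R * k%:R * ln 2 + _ in tail.
have l2 := ln2_ge R.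
have LL : L0 <= ln (ln (1 / hh)).
  have -> : L0 = ln ((w k)%:R * ln 2).
    rewrite lnM ?posrE ?ltr0n ?expn_gt0//; last by lra.
    by rewrite /scale natrX lnXn// -[_ *+ _]mulr_natl natrM.
  have wl : (w k)%:R * ln 2 <= ln (1 / hh).
    rewrite mulr_natl -lnXn// ler_ln ?posrE ?exprn_gt0 ?divr_gt0//.
    by rewrite ler_pdivlMr// -ler_pdivlMl ?exprn_gt0// mulr1 -exprVn ltW.
  have w0 : 0 < (w k)%:R * ln 2 :> R by rewrite mulr_gt0 ?ltr0n ?expn_gt0//; lra.
  by rewrite ler_ln ?posrE// (lt_le_trans w0).
have L00 : 0 < L0.
  have : 0 < (sa + 5) ^+ 2 by rewrite exprn_gt0// ltr_wpDl.
  move=> /lt_le_trans/(_ tail); rewrite pmulr_rgt0; last by rewrite exprn_gt0// addr_gt0.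
  by rewrite pmulr_rgt0.
set L := ln (ln _) in LL.
have L_0 : 0 < L by exact: lt_le_trans LL.
rewrite /lil_ratio -/hh -/L.
rewrite ler_pdivrMr ?sqrtr_gt0 ?mulr_gt0//.
apply: le_trans inc _.
have -> : Num.sqrt (2 * hh * L) = sh * Num.sqrt (2 * L).
  by rewrite -sqrtrM ?ltW//; congr Num.sqrt; ring.
rewrite mulrCA ler_pM2l//.
have p1 : 0 <= sa + 5 by rewrite addr_ge0.
have p3 : 0 <= (1 + de) * Num.sqrt (2 * L).
  by rewrite mulr_ge0 ?sqrtr_ge0// addr_ge0// ltW.
rewrite -(@ler_pXn2r _ 2) ?nnegrE// [leRHS]exprMn sqr_sqrtr; last by rewrite mulr_ge0// ltW.
apply: (le_trans tail); rewrite ler_wpM2l ?sqr_ge0//; lra.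
Qed.

Lemma lil_ge (de t : R) : 0 < de < 1 -> 0 <= t < 1 ->
  (1 - de) ^+ 2 * (2 * C%:R * ln 2) < a%:R ->
  (exists K, forall k, (K <= k)%N -> ~~ too_small psi C g a k (path_code k) (grid_index k t)) ->
  forall r : R, 0 < r -> exists h,
    [/\ h != 0, `|h| < r, 0 <= t + h <= 1 & 1 - de <= lil_ratio omega t h].
Proof.
move=> /andP[de0 de1] /andP[t0 t1] aC [K good] r r0.
have [k0 k0P] := sqrt_tail_ge _ C g a de aC.
(* With h < 1 - t the block fits in the grid, so the failure of [too_small] can only come from the
   displacement. *)
pose rho := Num.min r (1 - t).
have rho0 : 0 < rho by rewrite lt_min r0 subr_gt0.
have [kr krP] := eventually_le_nat R rho^-1.
(* The 3 ensures log (1/h) > 1, so that the iterated logarithm is positive. *)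
pose k := (K + k0 + kr + 3)%N.
have Kk : (K <= k)%N by rewrite /k; lia.
have k0k : (k0 <= k)%N by rewrite /k; lia.
have krk : (kr <= k)%N by rewrite /k; lia.
have k3 : (3 <= k)%N by rewrite /k; lia.
move: k Kk k0k krk k3 => k Kk k0k krk k3.
have := good k Kk; rewrite negb_forall => /existsP[j].
pose E := (g * (w k + j))%N.
pose h : R := 2^-1 ^+ E.
have jw : (w k + j <= w k.+1)%N.
  by have := ltn_ord j; have := leq_scale_scale _ _ (leqnSn k); lia.
have Eprec : (E <= prec k)%N by rewrite /precision (leq_trans _ (leq_addr _ _))// leq_mul2l jw orbT.
have kE : (k <= E)%N.
  apply: leq_trans (leq_scale k) _; apply: leq_trans (leq_addr j _) _.
  by rewrite leq_pmull.
have h0 : 0 < h by rewrite exprn_gt0// invr_gt0.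
have hrho : h < rho.
  apply: le_lt_trans (half_le _ _ kE) _.
  rewrite exprVn -[ltRHS]invrK ltf_pV2 ?posrE ?invr_gt0 ?exprn_gt0//.
  by apply: le_lt_trans (krP k krk) _; rewrite -natrX ltr_nat ltn_expl.
move: (hrho); rewrite lt_min => /andP[hr ht].
have th01 : 0 <= t + h <= 1 by rewrite addr_ge0 ?(ltW h0)//= -lerBrDl ltW.
have t01 : 0 <= t <= 1 by rewrite t0 ltW.
set n := N k.
have n0 : 0 < (n%:R : R) by exact: NR.
have blockE : (block psi C g k j)%:R = n%:R * h.
  have E2 : (block psi C g k j * 2 ^ E = n)%N.
    apply: divnK; apply: dvdn_mulr; rewrite -[4%N]/(2 ^ 2)%N -expnM dvdn_exp2l//.
    by rewrite (leq_trans Eprec)// leq_pmull.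
  by rewrite -E2 natrM natrX /h exprVn mulfK// expf_eq0 pnatr_eq0 andbF.
set i := grid_index k t.
have /andP[i1 i2] := grid_index_itv k _ t0; rewrite -/n -/i in i1 i2.
have grid_indexE : grid_index k (t + h) = (i + block psi C g k j)%N.
  apply: truncn_def; rewrite mulrDr -blockE -addSn !natrD lerD2r ltrD2r.
  by rewrite i1 i2.
have ib : (i + block psi C g k j <= n)%N by rewrite -grid_indexE grid_index_le.
rewrite -/n -/i ib /= -leqNgt -grid_indexE => Db.
set D := displacement _ _ _ in Db.
have sn0 : 0 < Num.sqrt n%:R :> R by rewrite sqrtr_gt0.
set sh := Num.sqrt h; pose sa : R := Num.sqrt (a * k)%:R.
have sh0 : 0 < sh by rewrite sqrtr_gt0.
have shge0 := ltW sh0.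
have sh2 : sh ^+ 2 = h by rewrite sqr_sqrtr// ltW.
have h1 : h <= 1 by rewrite /h -[leRHS](expr0 2^-1) half_le.
have sh1 : sh <= 1 by rewrite -(@expr_le1 _ 2) ?sh2.
have sa0 : 0 <= sa by exact: sqrtr_ge0.
have sa2 : sa ^+ 2 = (a * k)%:R by rewrite sqr_sqrtr.
have Dge : sh * sa <= D%:R / Num.sqrt n%:R.
  rewrite -(@ler_pXn2r _ 2) ?nnegrE ?mulr_ge0 ?invr_ge0 ?sqrtr_ge0//.
  rewrite expr_div_n exprMn sh2 sa2 sqr_sqrtr// ler_pdivlMr//.
  by rewrite mulrAC [h * _]mulrC -blockE mulrC -natrM -natrX ler_nat.
have e_le : 2^-1 ^+ prec k <= h by exact: half_le.
have inc : sh * (sa - 4) <= `|omega (t + h) - omega t|.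
  have := increment_approx k _ _ t01 th01; rewrite -/i -/n -/D ler_norml => /andP[h2 _].
  have : h <= sh by rewrite -sh2 expr2 ler_piMr.
  lra.
have [sa4 tail] := k0P k k0k; rewrite -/sa in sa4 tail.
set L0 := C%:R * k.+1%:R * ln 2 + _ in tail.
have l2 := ln2_ge R.
have lnh : ln (1 / h) = E%:R * ln 2.
  by rewrite /h exprVn div1r invrK lnXn// mulr_natl.
have E1 : 1 < E%:R * ln 2 :> R.
  have : 3 <= E%:R :> R by rewrite -[3]/(3%:R) ler_nat (leq_trans k3).
  by nra.
have LL : ln (ln (1 / h)) <= L0.
  have -> : L0 = ln ((g * w k.+1)%:R * ln 2).
    rewrite mulnC natrM -mulrA lnM ?posrE ?mulr_gt0 ?ltr0n ?expn_gt0//; last by lra.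
    by rewrite /scale natrX lnXn// -[_ *+ _]mulr_natl natrM.
  rewrite lnh ler_ln ?posrE; last 2 first.
  - by lra.
  - by rewrite mulr_gt0 ?ltr0n ?muln_gt0 ?expn_gt0 ?g_gt0//; lra.
  by rewrite ler_wpM2r ?ler_nat ?leq_mul2l ?jw ?orbT//; lra.
have L_0 : 0 < ln (ln (1 / h)) by rewrite lnh ln_gt0.
exists h; split => //; first by rewrite gt_eqF.
  by rewrite ger0_norm// ltW.
rewrite /lil_ratio (ger0_norm (ltW h0)); set L := ln (ln _) in LL L_0 *.
rewrite ler_pdivlMr; last by rewrite sqrtr_gt0 !mulr_gt0.
apply: le_trans inc.
have -> : Num.sqrt (2 * h * L) = sh * Num.sqrt (2 * L).
  by rewrite -sqrtrM ?(ltW h0)//; congr Num.sqrt; ring.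
rewrite mulrCA ler_pM2l//.
have p1 : 0 <= sa - 4 by rewrite subr_ge0.
have p3 : 0 <= (1 - de) * Num.sqrt (2 * L) by rewrite mulr_ge0 ?sqrtr_ge0// subr_ge0 ltW.
rewrite -(@ler_pXn2r _ 2) ?nnegrE// [leLHS]exprMn sqr_sqrtr; last by rewrite mulr_ge0// ltW.
by apply: le_trans tail; rewrite ler_wpM2l ?sqr_ge0//; lra.
Qed.

End Pointwise.

(** * The law of the iterated logarithm *)

(** One factor 1 + de pays for 1 / (1 - (mu - 1)^2) with mu = 1 + de / 2. The other pays for C + 4
    in place of C and for rounding [a] up, which is why C de >= 5. Bernoulli's inequality gives
    [q]. *)
Lemma too_large_parameters (R : realType) (de : R) : 0 < de < 1 ->
  exists C a q (mu : R), [/\ (0 < C)%N, (0 < q)%N, 1 < mu & 2 <= mu ^+ q] /\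
    (C + 4)%:R * ln 2 <= a%:R / 2 * (1 - (mu - 1) ^+ 2) /\
    a%:R < (1 + de) ^+ 2 * (2 * C%:R * ln 2).
Proof.
move=> /andP[de0 de1]; have l2 := ln2_ge R.
pose mu := 1 + de / 2; pose eta := (mu - 1) ^+ 2.
have etaE : eta = de ^+ 2 / 4 by rewrite /eta /mu; field.
have eta1 : 1 <= (1 + de) * (1 - eta).
  have -> : (1 + de) * (1 - eta) = 1 + de * (1 - de / 4 - de ^+ 2 / 4) by rewrite etaE; field.
  rewrite lerDl; apply: mulr_ge0; first exact: ltW.
  have : de ^+ 2 <= de by rewrite expr2; nra.
  by lra.
have eta0 : 0 < 1 - eta.
  by rewrite etaE expr2; nra.
have [C0 C0P] := eventually_le_nat R (5 / de).
have CP := C0P C0.+1 (leqnSn _); set C := C0.+1 in CP.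
have Cde : 5 <= C%:R * de by rewrite -ler_pdivrMr.
have [q0 q0P] := eventually_le_nat R (2 / de).
have qP := q0P q0.+1 (leqnSn _); set q := q0.+1 in qP.
pose X := 2 * (C + 4)%:R * ln 2 / (1 - eta).
have X0 : 0 <= X by rewrite divr_ge0 ?mulr_ge0// ?(ltW eta0)//; lra.
have /andP[a1 a2] := truncn_itv X0; set a0 := Num.truncn X in a1 a2.
exists C, a0.+1, q, mu; split.
  split => //; first by rewrite /mu; lra.
  have ber n : 1 + n%:R * (de / 2) <= mu ^+ n.
    elim: n => [|n IH]; first by rewrite mul0r addr0 expr0.
    rewrite exprS; apply: (@le_trans _ _ (mu * (1 + n%:R * (de / 2)))).
      have : 0 <= n%:R * (de / 2) * (de / 2) by rewrite !mulr_ge0//; lra.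
      by rewrite /mu -natr1; lra.
    by rewrite ler_wpM2l// /mu; lra.
  apply: le_trans (ber q).
  by move: qP; rewrite ler_pdivrMr//; lra.
split.
  rewrite -/eta -ler_pdivrMr//; move: (ltW a2); rewrite /X; lra.
rewrite -natr1; apply: (@le_lt_trans _ _ (X + 1)); first by lra.
have X1 : X <= (1 + de) * (2 * (C + 4)%:R * ln 2).
  rewrite ler_pdivrMr// [leRHS]mulrAC ler_peMl//.
  by rewrite !mulr_ge0//; lra.
apply: (le_lt_trans (lerD X1 (lexx 1))); rewrite natrD.
have G1 : 1 < (1 + de) * (2 * ln 2) by nra.
have : (1 + de) * (2 * ln 2) <= (1 + de) * (2 * ln 2) * (C%:R * de - 4).
  by rewrite ler_peMr//; [exact: le_trans (ltW G1)|lra].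
by lra.
Qed.

(** An integer [a] is needed between (1 - de)^2 and 1 - 2^-g times 2 C log 2. Taking it just above
    (1 - de) 2 C log 2 works: 2^-g <= de / 2, and C de >= 3 makes the gap exceed 1. *)
Lemma too_small_parameters (R : realType) (de : R) : 0 < de < 1 ->
  exists C g a, [/\ (0 < C)%N, (0 < g)%N,
    a%:R / (1 - 2^-1 ^+ g) / 2 < C%:R * ln (2 : R) &
    (1 - de) ^+ 2 * (2 * C%:R * ln 2) < a%:R].
Proof.
move=> /andP[de0 de1]; have l2 := ln2_ge R.
have [C0 C0P] := eventually_le_nat R (3 / de).
have CP := C0P C0.+1 (leqnSn _); set C := C0.+1 in CP.
have Cde : 3 <= C%:R * de by rewrite -ler_pdivrMr.
have [g0 g0P] := eventually_le_nat R (2 / de).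
have gP := g0P g0.+1 (leqnSn _); set g := g0.+1 in gP.
have gde : 2^-1 ^+ g <= de / 2.
  rewrite exprVn -[leRHS]invrK lef_pV2 ?posrE ?invr_gt0 ?exprn_gt0 ?divr_gt0// invf_div.
  by apply: le_trans gP _; rewrite -natrX ler_nat ltnW// ltn_expl.
pose X := 2 * C%:R * ln 2 * (1 - de).
have X0 : 0 <= X by rewrite !mulr_ge0//; lra.
have /andP[a1 a2] := truncn_itv X0; set a0 := Num.truncn X in a1 a2.
exists C, g, a0.+1; split => //.
  have p0 : 0 < 1 - 2^-1 ^+ g :> R by lra.
  rewrite ltr_pdivrMr// ltr_pdivrMr// -natr1.
  apply: (@le_lt_trans _ _ (X + 1)); first by lra.
  apply: (@lt_le_trans _ _ (C%:R * ln 2 * 2 * (1 - de / 2))); last first.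
    by rewrite ler_wpM2l ?mulr_ge0//; lra.
  rewrite /X; nra.
apply: le_lt_trans a2; rewrite /X mulrC ler_wpM2l ?mulr_ge0//; first by lra.
by rewrite expr2 ler_piMr//; lra.
Qed.

Definition ae_lebesgue_filter (R : realType) :
    Filter (almost_everywhere (@lebesgue_measure R)) :=
  @ae_filter_ringOfSetsType _ _ _ (@lebesgue_measure R).

Section Main.
Variables (R : realType) (U : machine) (omega : R -> R).
Hypothesis hU : universal_prefix_machine R U.
Hypothesis homega : complex_oscillation U omega.

Lemma ae_lil_le (de : R) : 0 < de < 1 ->
  {ae @lebesgue_measure R, forall t : R, 0 <= t < 1 ->
    exists2 r : R, 0 < r & forall h, h != 0 -> `|h| < r -> 0 <= t + h <= 1 ->
      lil_ratio omega t h <= 1 + de}.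
Proof.
move=> de01; have [C [a [q [mu [[C0 q0 mu1 muq] [aC1 aC2]]]]]] := too_large_parameters R de de01.
have [Cw [x_ [Cx [d Kx]] [psi cpsi conv]]] := homega.
(* With [g = 1] the error 2^-precision is already at most |h| throughout the window. *)
have [k0 k0P] := too_large_prob R psi C 1 a mu q q0 mu1 muq aC1.
have [K KP] := @few_failures R U (resolution psi C 1) (too_large psi C 1 a)
  (fun n => slope_code n (x_ n)) d k0 hU (computable_resolution psi C 1 cpsi)
  (resolution_gt0 psi C 1) (recursive_too_large psi C 1 a cpsi)
  (fun n => size_mkseq _ _) Kx k0P.
have := ae_eventually_good R _
  (fun k i => too_large psi C 1 a k (path_code R psi C 1 x_ k) i) K (resolution_gt0 psi C 1) KP.
apply: (@filterS _ _ (ae_lebesgue_filter R)) => t good t01.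
have /andP[de0 _] := de01; have /andP[t0 t1] := t01.
have t01' : 0 <= t <= 1 by rewrite t0 ltW.
exact: (lil_le R psi C 1 a omega x_ Cw Cx conv C0 isT de t de0 t01' aC2 (good t01)).
Qed.

Lemma ae_lil_ge (de : R) : 0 < de < 1 ->
  {ae @lebesgue_measure R, forall t : R, 0 <= t < 1 ->
    forall r : R, 0 < r -> exists h,
      [/\ h != 0, `|h| < r, 0 <= t + h <= 1 & 1 - de <= lil_ratio omega t h]}.
Proof.
move=> de01; have [C [g [a [C0 g0 aC1 aC2]]]] := too_small_parameters R de de01.
have [Cw [x_ [Cx [d Kx]] [psi cpsi conv]]] := homega.
have [k0 k0P] := too_small_prob R psi C g a C0 g0 aC1.
have [K KP] := @few_failures R U (resolution psi C g) (too_small psi C g a)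
  (fun n => slope_code n (x_ n)) d k0 hU (computable_resolution psi C g cpsi)
  (resolution_gt0 psi C g) (recursive_too_small psi C g a cpsi)
  (fun n => size_mkseq _ _) Kx k0P.
have := ae_eventually_good R _
  (fun k i => too_small psi C g a k (path_code R psi C g x_ k) i) K (resolution_gt0 psi C g) KP.
apply: (@filterS _ _ (ae_lebesgue_filter R)) => t good t01.
exact: (lil_ge R psi C g a omega x_ Cw Cx conv C0 g0 de t de01 t01 aC2 (good t01)).
Qed.

End Main.

(** The errors start at 1/2 so that each lies strictly between 0 and 1, as the choice of parameters
    demands. *)
Lemma limf_esup_increments (R : realType) (f : R -> R) (t l : R) :
  (forall n, exists2 r : R, 0 < r & forall h, h != 0 -> `|h| < r -> 0 <= t + h <= 1 ->
      f h <= l + n.+2%:R^-1) ->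
  (forall n (r : R), 0 < r -> exists h,
      [/\ h != 0, `|h| < r, 0 <= t + h <= 1 & l - n.+2%:R^-1 <= f h]) ->
  limf_esup (fun h => (f h)%:E) (increments t) = l%:E.
Proof.
move=> ub lb.
have small (e : R) : 0 < e -> exists n, n.+2%:R^-1 <= e.
  move=> e0; have [k kP] := eventually_le_nat R e^-1; exists k.
  rewrite -[leRHS]invrK lef_pV2 ?posrE ?invr_gt0//.
  by apply: kP; rewrite ltnW.
apply/eqP; rewrite eq_le; apply/andP; split.
  apply/lee_addgt0Pr => e /small[n ne]; have [r r0 rP] := ub n.
  apply: (@le_trans _ _ (l + n.+2%:R^-1)%:E); last by rewrite -EFinD lee_fin lerD2l.
  pose V := [set h : R | [/\ h != 0, `|h| < r & 0 <= t + h <= 1]].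
  apply: (@le_trans _ _ (ereal_sup [set (f h)%:E | h in V])).
    apply: ereal_inf_lbound; exists V => //.
    exists r => //= h; rewrite /= sub0r normrN => hr hn0; rewrite in_itv /=.
    by move=> th; split.
  by apply: ge_ereal_sup => _ [h [h1 h2 h3] <-]; rewrite lee_fin rP.
apply: le_ereal_inf_tmp => _ [V VP <-].
have [r r0 rP] := VP.
apply/lee_addgt0Pr => e /small[n ne]; have [h [h1 h2 h3 h4]] := lb n r r0.
have Vh : V h by apply: rP => //=; rewrite sub0r normrN.
apply: (@le_trans _ _ ((f h)%:E + e%:E)%E).
  by rewrite -EFinD lee_fin -lerBlDr; apply: le_trans h4; rewrite lerD2l lerN2.
by rewrite leeD2r// ereal_sup_ubound//; exists h.
Qed.

Theorem theorem3p4 (R : realType) (U : machine)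
    (hU : universal_prefix_machine R U)
    (omega : R -> R) (homega : complex_oscillation U omega) :
  {ae @lebesgue_measure R, forall t : R, t \in `[0, 1]%R ->
     limf_esup (fun h : R => (lil_ratio omega t h)%:E) (increments t) = 1%E}.
Proof.
have de01 n : 0 < (n.+2%:R^-1 : R) < 1.
  by rewrite invr_gt0 ltr0n invf_lt1 ?ltr1n ?ltr0n.
(* Parameters, tests and null sets all depend on de; countably many values keep the union null. *)
have U1 := ae_foralln (fun n => ae_lil_le R U omega hU homega _ (de01 n)).
have L1 := ae_foralln (fun n => ae_lil_ge R U omega hU homega _ (de01 n)).
(* The cells of the grid are half-open, so t = 1 lies in none of them and is discarded as a null
   set. *)
have neq1 : {ae @lebesgue_measure R, forall t, t != 1}.
  exists [set 1]; split => //; first exact: lebesgue_measure_set1.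
  by move=> t /= /negP; rewrite negbK => /eqP.
apply: (@filterS3 _ _ (ae_lebesgue_filter R)) U1 L1 neq1 => t ut lt tn1; rewrite in_itv /= => /andP[t0 t1].
have t01 : 0 <= t < 1 by rewrite t0 lt_neqAle tn1.
by apply: limf_esup_increments => n; [exact: ut|exact: lt].
Qed.
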